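(* For every $n\ge 4$, $R(\mathcal{C}^4_n,\mathcal{C}^4_n)\le 3n+\lfloor\frac{n}{2}\rfloor$.
   Context: $\mathcal{C}^4_n$ is the $4$-uniform loose cycle: vertex set $\{v_1,\dots,v_{3n}\}$ and edges $\{v_{3i-2},v_{3i-1},v_{3i},v_{3i+1}\}$, $1\le i\le n$, indices modulo $3n$. $R(\mathcal{G},\mathcal{H})$ is the least $N$ such that every red/blue coloring of the edges of the complete $4$-uniform hypergraph $\mathcal{K}^4_N$ contains a red copy of $\mathcal{G}$ or a blue copy of $\mathcal{H}$. *)

(* Defs.v *)
From mathcomp Require Import all_boot.
Set Implicit Arguments. Unset Strict Implicit. Unset Printing Implicit Defensive.

(* Vertices of K^4_N are 'I_N; a red/blue colouring of the edges of the
   complete 4-uniform hypergraph is a function on subsets of 'I_N, of which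
   only the 4-element subsets matter.  [true] = red, [false] = blue. *)
Definition coloring (N : nat) := {set 'I_N} -> bool.

(* The i-th edge (0-indexed, i < n) of the 4-uniform loose cycle C^4_n on
   vertex set {0,...,3n-1} (0-indexed version of v_1..v_{3n}):
   {3i, 3i+1, 3i+2, 3i+3 mod 3n}. *)
Definition loose_edge (n i : nat) : seq nat :=
  [:: 3 * i; 3 * i + 1; 3 * i + 2; (3 * i + 3) %% (3 * n)].

Definition mono_loose_cycle (N : nat) (c : coloring N) (b : bool) (n : nat) : Prop :=
  exists f : nat -> 'I_N,
    {in [pred k | k < 3 * n] &, injective f} /\
    forall i, i < n -> c [set x | x \in map f (loose_edge n i)] = b.

Definition ramsey_arrows (N n m : nat) : Prop :=
  forall c : coloring N, mono_loose_cycle c true n \/ mono_loose_cycle c false m.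

(* Main.v *)
Require Import Defs.
From mathcomp Require Import all_boot zify.
From Stdlib Require Import String Ascii.
Set Implicit Arguments. Unset Strict Implicit. Unset Printing Implicit Defensive.

(* Induction on n.  Let C be a red C_m, m = n - 1, let W be the set of vertices
   outside C, and suppose that there is no red C_n.  Cut C into windows of two
   consecutive edges.  Forbidding the red paths that would lengthen C forces
   many blue two-edge paths joining two vertices of W through five vertices of
   a window; strung together, they use one vertex of W for every two edges of
   C, and |W| is just large enough to close them up into a blue C_n.
   The blue path of a window must leave a vertex of the last edge of the
   window unused, to be available for the next window.  This is the joint of
   the two windows, or else an inner vertex u of that edge: the red cycle may
   leave the edge at u as well as at the joint, so that the next window can be
   treated with u in place of its first vertex.
   The statements about a single window are finite; each is certified by a
   short list of paths that cannot all be avoided. *)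

(** * Finite certificates *)

(** With n = m + 1 the bound guarantees floor((m+1)/2) + 3 vertices outside C. The obstacle is the
    end of the blue cycle. Windows contribute an even number of edges, so two or three edges remain
    to be closed over the last three or six vertices of C, and the joint after these is the first
    vertex of the first window, which may already be in use. This is why it matters whether the
    paths of a window can spare its first vertex. If some window has such paths, the blue cycle
    starts there and the last stretch of C is available with both its ends. If none has, no window
    ever hands on an inner vertex, and a missing closing path would itself force such a window.
    Pairs of vertices of W not joined in a window form a graph. A vertex cover of size 2 is a set of
    exceptions small enough to avoid; each minimal graph without one is a finite configuration that
    forces the other kind of path. The induction rests on cycles of three edges, for which 14
    vertices are used: the bound for n = 4, not the value 10 of the formula at n = 3. *)

Section Refutation.

(** A propositional variable is an edge, given by the list of its vertex codes; [(e, b)] asserts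
    that [e] has colour [b], with [true] for red. *)
Definition literal : Type := seq nat * bool.
Definition clause := seq literal.

Definition assign (l : literal) (F : seq clause) : seq clause :=
  [seq [seq k <- C | k.1 != l.1] | C <- F & l \notin C].

Definition shortest (F : seq clause) : clause :=
  foldr (fun C D => if size C <= size D then C else D) (head [::] F) F.

(** Splitting on a shortest clause subsumes unit propagation: for a unit clause one branch contains
    the empty clause at once. Only the answer [true] carries information. The final test is there
    because the empty formula, too, has an empty [shortest]. *)
Fixpoint refute (fuel : nat) (F : seq clause) : bool :=
  if fuel is n.+1 then
    if shortest F is l :: _ then
      refute n (assign (l.1, true) F) && refute n (assign (l.1, false) F)
    else [::] \in F
  else false.

Definition satisfies (val : seq nat -> bool) (C : clause) :=
  has (fun l => val l.1 == l.2) C.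

Lemma assign_sat val e F :
  all (satisfies val) F -> all (satisfies val) (assign (e, val e) F).
Proof.
move=> /allP satF; apply/allP=> D /mapP[C]; rewrite mem_filter => /andP[eC CF] ->.
have /hasP[[e' b] lC /= vl] := satF C CF; apply/hasP; exists (e', b) => //=.
rewrite mem_filter lC andbT /=; apply: contraNneq eC => E; rewrite -E.
by rewrite (eqP vl).
Qed.

Lemma refute_sound val n F : all (satisfies val) F -> refute n F = false.
Proof.
elim: n F => //= n IH F satF; case: shortest => [|l _].
  by apply: contraTF satF => nilF; rewrite -has_predC; apply/hasP; exists [::].
have := assign_sat l.1 satF.
by case: (val l.1) => /IH ->; rewrite ?andbF.
Qed.

End Refutation.

(** * Loose paths with prescribed ends *)

Section LoosePaths.
Variables (T : finType) (c : {set T} -> bool).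
Implicit Types (l q r s A W : seq T) (x y z u : T) (b : bool).

Definition hue l := c [set x in l].

Lemma hue_eq l l' : l =i l' -> hue l = hue l'.
Proof. by move=> E; congr c; apply/setP=> x; rewrite !inE E. Qed.

Lemma hue_rev l : hue (rev l) = hue l.
Proof. by apply: hue_eq => x; rewrite mem_rev. Qed.

(** The end [y] is kept outside the list, which has three entries per edge: paths are then
    concatenated without repeating the joint, and a cycle is a path that ends at its own first
    vertex. *)
Fixpoint lpath b l y : bool :=
  if l is x :: p :: q :: l' then
    (hue [:: x; p; q; head y l'] == b) && lpath b l' y
  else true.
Arguments lpath : simpl nomatch.

Lemma lpath_cat b k l l' y : size l = 3 * k ->
  lpath b (l ++ l') y = lpath b l (head y l') && lpath b l' y.
Proof.
elim: k l => [|k IH] l; first by rewrite muln0 => /size0nil ->.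
rewrite mulnS; case: l => [|x [|p [|q l]]] //= [szl].
by rewrite IH // andbA; congr (_ && _ && _); case: l {szl}.
Qed.

Lemma lpath_rev b k x y q : size q = 3 * k + 2 ->
  lpath b (x :: q) y = lpath b (y :: rev q) x.
Proof.
elim: k x q => [|k IH] x q.
  case: q => [|p [|q [|]]] //= _.
  by rewrite !andbT -(hue_rev [:: x; p; q; y]).
rewrite mulnS -addnA; case: q => [|p [|q [|z r]]] //= [szr].
rewrite (IH z r szr) andbC.
have -> : rev [:: p, q, z & r] = rev r ++ [:: z; q; p].
  by rewrite !rev_cons -!cats1 -!catA.
rewrite -cat_cons.
rewrite (@lpath_cat b k.+1) /= ?size_rev ?szr; last by lia.
by rewrite andbT -(hue_rev [:: x; p; q; z]).
Qed.

(** A loose path of k edges has 3k + 1 vertices, hence 3k - 1 between its ends. *)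
Definition joined b k x y A : bool :=
  [exists q : (3 * k).-1.-tuple T,
    [&& uniq (x :: y :: q), all (mem A) q & lpath b (x :: q) y]].

Arguments joined : simpl never.

Lemma joinedP b k x y A :
  reflect (exists q, [/\ size q = (3 * k).-1, uniq (x :: y :: q),
                         {subset q <= A} & lpath b (x :: q) y])
          (joined b k x y A).
Proof.
apply: (iffP existsP) => [[q /and3P[uq /allP qA pq]]|[q [szq uq qA pq]]].
  by exists q; rewrite size_tuple.
by exists (Tuple (introT eqP szq)); apply/and3P; split=> //; apply/allP.
Qed.

Lemma joined_sub b k x y A A' : {subset A <= A'} ->
  joined b k x y A -> joined b k x y A'.
Proof.
move=> sAA' /joinedP[q [szq uq qA pq]]; apply/joinedP; exists q; split=> //.
by move=> z /qA /sAA'.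
Qed.

Lemma joinedC b k x y A : 0 < k -> joined b k x y A = joined b k y x A.
Proof.
move=> k0; have imp u v : joined b k u v A -> joined b k v u A.
  move=> /joinedP[q [szq uq qA pq]]; apply/joinedP; exists (rev q); split.
  - by rewrite size_rev.
  - move: uq; rewrite /= !inE !mem_rev rev_uniq eq_sym.
    by case: eqP => //= _; rewrite andbCA.
  - by move=> z; rewrite mem_rev => /qA.
  - by rewrite -(@lpath_rev b k.-1) // szq; lia.
by apply/idP/idP; apply: imp.
Qed.

End LoosePaths.
Arguments joined : simpl never.
Arguments lpath : simpl nomatch.

(** * Checking path certificates by computation *)

Section Certificates.

(** The tuple [(b, k, x, y, A)] records that no loose path of colour [b] with [k] edges leads from
    [x] to [y] through [A], all vertices being codes. *)
Definition spec : Type := bool * nat * nat * nat * seq nat.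

(** Sorting makes paths that run through the same four vertices in different orders refer to the
    same variable. *)
Fixpoint path_edges (l : seq nat) (y : nat) : seq (seq nat) :=
  if l is x :: p :: q :: l' then
    sort leq [:: x; p; q; head y l'] :: path_edges l' y
  else [::].

Definition fits (p : seq nat) (s : spec) : bool :=
  let: (_, k, x, y, A) := s in
  let l := belast (head 0 p) (behead p) in
  [&& 0 < k, uniq p, size p == (3 * k).+1, head 0 p == x, last 0 p == y
    & all (mem A) (behead l)].

(** A path excluded by a spec has an edge of the opposite colour; this disjunction is the clause. *)
Definition path_clauses (sp : seq spec) (p : seq nat) : seq clause :=
  let l := belast (head 0 p) (behead p) in
  [seq [seq (e, ~~ s.1.1.1.1) | e <- path_edges l (last 0 p)]
    | s <- sp & fits p s].

(* A certificate lists loose paths separated by blanks.  The digits stand for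
   consecutive vertices of the red cycle, the letters for vertices outside. *)
Definition vertex_code (a : ascii) : nat :=
  let n := nat_of_ascii a in if n < 97 then n - 48 else n - 87.

(** Every character whose code is below that of [0] ends a path, so line breaks inside a certificate
    act like blanks. *)
Fixpoint decode (p : seq nat) (t : string) : seq (seq nat) :=
  if t is String a t' then
    if nat_of_ascii a < 48 then rev p :: decode [::] t'
    else decode (vertex_code a :: p) t'
  else [:: rev p].

Definition valid_code (nv nw i : nat) : bool :=
  if i < 10 then i < nv else i - 10 < nw.

(** The string needs no trust: paths with invalid codes are filtered out and paths fitting no spec
    give no clause, so a wrong certificate can only make the test fail. *)
Definition contradictory nv nw (sp : seq spec) (known : seq literal) t :=
  refute 100 ([seq [:: l] | l <- known] ++
    flatten [seq path_clauses sp p | p <- decode [::] t & all (valid_code nv nw) p]).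

Variables (T : finType) (c : {set T} -> bool) (x0 : T) (vs ws : seq T).
Hypothesis uvw : uniq (vs ++ ws).

Definition vertex (i : nat) : T :=
  if i < 10 then nth x0 vs i else nth x0 ws (i - 10).

Definition holds (s : spec) : bool :=
  let: (b, k, x, y, A) := s in
  ~~ joined c b k (vertex x) (vertex y) (map vertex A).

Let colour (e : seq nat) := hue c (map vertex e).

Lemma vertex_inj : {in valid_code (size vs) (size ws) &, injective vertex}.
Proof.
have [uv [dvw uw]] : uniq vs /\ ~~ has (mem vs) ws /\ uniq ws.
  by move: uvw; rewrite cat_uniq => /and3P[].
have disj i j : i < size vs -> j < size ws -> nth x0 vs i = nth x0 ws j -> False.
  move=> iv jw E; case/hasP: dvw; exists (nth x0 ws j); first exact: mem_nth.
  by rewrite -E; apply: mem_nth.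
move=> i j; rewrite !unfold_in /vertex /valid_code.
case: (ltnP i 10) => i10; case: (ltnP j 10) => j10 hi hj E.
- by apply/eqP; rewrite -(nth_uniq x0 hi hj uv) E.
- by case: (disj _ _ hi hj).
- by case: (disj _ _ hj hi).
- by move/eqP: E; rewrite nth_uniq // => /eqP; lia.
Qed.

Lemma lpath_edges b l y :
  lpath c b (map vertex l) (vertex y) =
  all (fun e => colour e == b) (path_edges l y).
Proof.
have [n] := ubnP (size l); elim: n l => // n IH [|x [|p [|q l]]] //= szl.
rewrite -IH; last by lia.
congr ((_ == _) && _); rewrite /colour; apply: hue_eq => z.
rewrite (@eq_mem_map _ _ vertex _ [:: x; p; q; head y l]); last first.
  by move=> t; rewrite mem_sort.
by case: l {szl}.
Qed.

Lemma fits_sat (b : bool) (k x y : nat) (A p : seq nat) :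
  all (valid_code (size vs) (size ws)) p ->
  fits p (b, k, x, y, A) -> holds (b, k, x, y, A) ->
  satisfies colour [seq (e, ~~ b)
    | e <- path_edges (belast (head 0 p) (behead p)) (last 0 p)].
Proof.
move=> vp /andP[k0 /and5P[up /eqP szp /eqP hx /eqP ly qA]].
apply: contraNT => unsat; apply/joinedP.
case: p vp up szp hx ly qA unsat => [|x' p] //= /andP[vx vp] up szp hx ly qA.
rewrite {x'}hx in vx up ly qA *.
case/lastP: p vp up szp ly qA => [|p y'] vp up szp ly qA; first by move: szp => /=; lia.
rewrite last_rcons in ly; rewrite {y'}ly belast_rcons last_rcons /= in vp up szp qA *.
rewrite size_rcons in szp; rewrite all_rcons in vp; case/andP: vp => vy vp.
move=> unsat; exists (map vertex p); split.
- by rewrite size_map; move: szp; lia.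
- suff: uniq (map vertex [:: x, y & p]) by [].
  rewrite map_inj_in_uniq; first by move: up;
    rewrite /= !inE mem_rcons rcons_uniq !inE negb_or -!andbA.
  apply: sub_in2 vertex_inj => i.
  by rewrite !inE unfold_in => /or3P[/eqP->|/eqP->|/(allP vp)].
- by move=> _ /mapP[i /(allP qA) iA ->]; apply: map_f.
suff: lpath c b (map vertex (x :: p)) (vertex y) by []; rewrite lpath_edges.
apply: contraR unsat => /allPn[e ee ne]; apply/hasP.
by exists (e, ~~ b); [apply/mapP; exists e | move: ne => /=; case: colour; case: (b)].
Qed.

Lemma path_clauses_sat sp p :
  all (valid_code (size vs) (size ws)) p -> all holds sp ->
  all (satisfies colour) (path_clauses sp p).
Proof.
move=> vp /allP spP; apply/allP=> C /mapP[s]; rewrite mem_filter.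
case/andP=> fps /spP hs ->.
by case: s fps hs => [[[[b k] x] y] A] fps hs; apply: (fits_sat vp fps hs).
Qed.

Lemma contradiction sp known t :
  all holds sp -> all (fun l => colour l.1 == l.2) known ->
  contradictory (size vs) (size ws) sp known t -> False.
Proof.
move=> spP kP; rewrite /contradictory (@refute_sound colour) // all_cat.
apply/andP; split.
  apply/allP=> C /mapP[l lk ->]; rewrite /satisfies /= orbF.
  exact: (allP kP).
apply/allP=> C /flattenP[F /mapP[p]]; rewrite mem_filter => /andP[vp _] ->.
exact/allP/path_clauses_sat.
Qed.

End Certificates.

(** * Graphs without a small vertex cover *)

Section VertexCover.
Variables (T : finType) (E : rel T).
Hypothesis Esym : symmetric E.
Implicit Types a b c d e f w x y : T.

Definition covered (B : seq T) := forall x y, E x y -> (x \in B) || (y \in B).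

Definition conf_K4 a b c d :=
  uniq [:: a; b; c; d] && [&& E a b, E a c, E a d, E b c, E b d & E c d].
Definition conf_C5 a b c d e :=
  uniq [:: a; b; c; d; e] && [&& E a b, E b c, E c d, E d e & E e a].
Definition conf_K2K3 a b c d e :=
  uniq [:: a; b; c; d; e] && [&& E a b, E c d, E d e & E c e].
Definition conf_3K2 a b c d e f :=
  uniq [:: a; b; c; d; e; f] && [&& E a b, E c d & E e f].

(* The last four cases are the minimal graphs without a vertex cover of size 2. *)
Variant cover_spec : Prop :=
| SmallCover B of size B <= 2 & covered B
| HasK4 a b c d of conf_K4 a b c d
| HasC5 a b c d e of conf_C5 a b c d e
| HasK2K3 a b c d e of conf_K2K3 a b c d e
| Has3K2 a b c d e f of conf_3K2 a b c d e f.

Lemma avoid (B : seq T) : size B <= 2 ->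
  cover_spec \/ exists x y, [/\ E x y, x \notin B & y \notin B].
Proof.
move=> szB; case: (boolP [forall x, forall y, E x y ==> (x \in B) || (y \in B)]).
  move=> /'forall_forallP H; left; apply: SmallCover szB _ => x y.
  exact/implyP.
rewrite negb_forall => /existsP[x]; rewrite negb_forall => /existsP[y].
rewrite negb_imply negb_or => /and3P[Exy xB yB].
by right; exists x, y.
Qed.

Definition leaves (S : seq T) v := [exists w, (w \notin S) && E v w].

Lemma notin_neq (S : seq T) v w : v \in S -> w \notin S -> v != w.
Proof. by move=> vS wS; apply: contraNneq wS => <-. Qed.

Ltac by_conf :=
  rewrite /conf_K4 /conf_C5 /conf_K2K3 /conf_3K2 /= ?inE ?negb_or;
  repeat (apply/andP; split);
  first [assumption | by rewrite eq_sym | by rewrite Esym | done].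

Ltac outside H w :=
  let wS := fresh in
  case/existsP: H => w /andP[wS ?];
  repeat match goal with
  | vS : is_true (?v \in _) |- _ =>
      have ? := notin_neq vS wS; move: vS; clear vS
  end; move=> *.

(** The edge xy witnesses that {a, c} is not a cover. Together with ab and cd it is a matching of
    three edges, unless it meets b or d; then it is bd or it leads out of S. *)
Lemma cover_touch (S : seq T) a b c d x y :
  (forall v, (v \in S) = [|| v == a, v == b, v == c | v == d]) ->
  a != b -> a != c -> a != d -> b != c -> b != d -> c != d ->
  E a b -> E c d -> E x y -> x != y ->
  x \notin [:: a; c] -> y \notin [:: a; c] ->
  cover_spec \/ [|| E b d, leaves S b | leaves S d].
Proof.
move=> SE ab ac ad bc bd cd Eab Ecd Exy xy.
rewrite !inE !negb_or => /andP[xa xc] /andP[ya yc].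
have lv v w : w != a -> w != b -> w != c -> w != d -> E v w -> leaves S v.
  move=> wa wb wc wd Evw; apply/existsP; exists w.
  by rewrite SE !negb_or wa wb wc wd.
have [xb|xb] := eqVneq x b.
  move: Exy xy; rewrite xb => Eby b_y.
  have [yd|yd] := eqVneq y d; first by right; rewrite -yd Eby.
  by right; rewrite (lv b y) ?orbT // eq_sym.
have [xd|xd] := eqVneq x d.
  move: Exy xy; rewrite xd => Edy d_y.
  have [yb|yb] := eqVneq y b; first by right; rewrite -yb Esym Edy.
  by right; rewrite (lv d y) ?orbT // eq_sym.
have [yb|yb] := eqVneq y b.
  by right; rewrite (lv b x) ?orbT // -yb Esym.
have [yd|yd] := eqVneq y d.
  by right; rewrite (lv d x) ?orbT // -yd Esym.
by left; apply: (@Has3K2 a b c d x y); by_conf.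
Qed.

(** This is the situation in which neither a nor c has a neighbour outside S: that {b, d}, {b, c},
    {a, d} and {a, c} are not covers gives the edge ac and the three disjunctions. When neither ad
    nor bc is at hand, exits from b and d give a pentagon if they lead to the same vertex, and three
    disjoint edges otherwise. *)
Lemma cover_core (S : seq T) a b c d :
  a \in S -> b \in S -> c \in S -> d \in S ->
  a != b -> a != c -> a != d -> b != c -> b != d -> c != d ->
  E a b -> E c d -> E a c -> E a d || leaves S d -> E b c || leaves S b ->
  [|| E b d, leaves S b | leaves S d] -> cover_spec.
Proof.
move=> aS bS cS dS ab ac ad bc bd cd Eab Ecd Eac.
case/orP=> [Ead|].
  case/orP=> [Ebc|]; last first.
    by move=> H _; outside H w; apply: (@HasK2K3 b w a c d); by_conf.
  case/or3P=> [Ebd|H|H].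
  - by apply: (@HasK4 a b c d); by_conf.
  - by outside H w; apply: (@HasK2K3 b w a c d); by_conf.
  - by outside H w; apply: (@HasK2K3 d w a b c); by_conf.
move=> Hd; case/orP=> [Ebc _|Hb _].
  by outside Hd w; apply: (@HasK2K3 d w a b c); by_conf.
case/existsP: Hd => w /andP[wS Edw]; case/existsP: Hb => v /andP[vS Ebv].
have [aw bw cw dw] := And4 (notin_neq aS wS) (notin_neq bS wS)
  (notin_neq cS wS) (notin_neq dS wS).
have [av bv cv dv] := And4 (notin_neq aS vS) (notin_neq bS vS)
  (notin_neq cS vS) (notin_neq dS vS).
have [vw|vw] := eqVneq v w; last by apply: (@Has3K2 b v d w a c); by_conf.
by rewrite vw in Ebv; apply: (@HasC5 a b w d c); by_conf.
Qed.

Lemma coverP : irreflexive E -> cover_spec.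
Proof.
move=> Eirr; have neq x y : E x y -> x != y.
  by apply: contraTneq => ->; rewrite Eirr.
have [//|[a [b [Eab _ _]]]] := @avoid [::] isT.
have [//|[c [d [Ecd]]]] := @avoid [:: a; b] isT.
rewrite !inE !negb_or => /andP[ca cb] /andP[da db].
have [ab cd] := (neq _ _ Eab, neq _ _ Ecd).
pose S := [:: a; b; c; d].
have touch a' b' c' d' :
    (forall v, (v \in S) = [|| v == a', v == b', v == c' | v == d']) ->
    uniq [:: a'; b'; c'; d'] ->
    E a' b' -> E c' d' -> cover_spec \/ [|| E b' d', leaves S b' | leaves S d'].
  move=> SE; rewrite /= !inE !negb_or.
  case/and4P=> /and3P[ab' ac' ad'] /andP[bc' bd'] cd' _ Eab' Ecd'.
  have [|[x [y [Exy xN yN]]]] := @avoid [:: a'; c'] isT; first by left.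
  by apply: (@cover_touch S a' b' c' d' x y) => //; exact: neq.
have [Eba Edc] : E b a /\ E d c by rewrite ![E b a]Esym ![E d c]Esym.
have SP v : (v \in S) = [|| v == a, v == b, v == c | v == d] by rewrite !inE.
have [//|bd] : cover_spec \/ [|| E b d, leaves S b | leaves S d].
  apply: (touch a b c d) => //; solve [by_conf |
    by move=> v; rewrite SP; case: (v == a); case: (v == b); case: (v == c); case: (v == d)].
have [//|bc] : cover_spec \/ [|| E b c, leaves S b | leaves S c].
  apply: (touch a b d c) => //; solve [by_conf |
    by move=> v; rewrite SP; case: (v == a); case: (v == b); case: (v == c); case: (v == d)].
have [//|ad] : cover_spec \/ [|| E a d, leaves S a | leaves S d].
  apply: (touch b a c d) => //; solve [by_conf |
    by move=> v; rewrite SP; case: (v == a); case: (v == b); case: (v == c); case: (v == d)].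
have [//|ac] : cover_spec \/ [|| E a c, leaves S a | leaves S c].
  apply: (touch b a d c) => //; solve [by_conf |
    by move=> v; rewrite SP; case: (v == a); case: (v == b); case: (v == c); case: (v == d)].
have [aS bS cS dS] : [/\ a \in S, b \in S, c \in S & d \in S].
  by rewrite !SP !eqxx !orbT.
(* If both ends of vw leave S, the two exits and xy are three disjoint edges, or the exits meet and
   close a triangle disjoint from xy. *)
have two v w x y : v \in S -> w \in S -> x \in S -> y \in S ->
    v != w -> x != y -> v != x -> v != y -> w != x -> w != y ->
    E v w -> E x y -> leaves S v -> leaves S w -> cover_spec.
  move=> vS wS xS yS vw xy vx vy wx wy Evw Exy.
  case/existsP=> p /andP[pS Evp] /existsP[q /andP[qS Ewq]].
  have [vp wp xp yp] := And4 (notin_neq vS pS) (notin_neq wS pS)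
    (notin_neq xS pS) (notin_neq yS pS).
  have [vq wq xq yq] := And4 (notin_neq vS qS) (notin_neq wS qS)
    (notin_neq xS qS) (notin_neq yS qS).
  have [pq|pq] := eqVneq p q; last by apply: (@Has3K2 v p w q x y); by_conf.
  by rewrite -pq in Ewq; apply: (@HasK2K3 x y v w p); by_conf.
(* By [two], each of ab and cd keeps an end without exit from S; these two ends take the places of a
   and c in [cover_core]. *)
have [La|La] := boolP (leaves S a).
  have [Lb|Lb] := boolP (leaves S b); first by apply: (two a b c d) => //; by_conf.
  have [Lc|Lc] := boolP (leaves S c).
    have [Ld|Ld] := boolP (leaves S d); first by apply: (two c d a b) => //; by_conf.
    rewrite ?(negbTE Lb) ?(negbTE Ld) /= ?orbF in bd bc ad ac.
    by apply: (@cover_core S b a d c); rewrite ?La ?Lc ?orbT //; by_conf.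
  rewrite ?(negbTE Lb) ?(negbTE Lc) /= ?orbF in bd bc ad ac.
  by apply: (@cover_core S b a c d); rewrite ?La ?orbT //; by_conf.
have [Lc|Lc] := boolP (leaves S c).
  have [Ld|Ld] := boolP (leaves S d); first by apply: (two c d a b) => //; by_conf.
  rewrite ?(negbTE La) ?(negbTE Ld) /= ?orbF in bd bc ad ac.
  by apply: (@cover_core S a b d c); rewrite ?Lc ?orbT //; by_conf.
rewrite ?(negbTE La) ?(negbTE Lc) /= ?orbF in bd bc ad ac.
by apply: (@cover_core S a b c d) => //; by_conf.
Qed.

End VertexCover.

(** * Windows of the red cycle *)

Section LocalLemmas.
Variables (T : finType) (c : {set T} -> bool).
Implicit Types (u x y z p q r a b d f : T) (W ws : seq T).

(* The vertex [u] is either the left end of the window or the unused vertex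
   carried over from the preceding edge; in the latter case the edge
   [u s1 s2 s3] may be blue. *)
Definition window u s1 s2 s3 s4 s5 s6 W :=
  [&& uniq ([:: u; s1; s2; s3; s4; s5; s6] ++ W),
      hue c [:: s3; s4; s5; s6],
      ~~ joined c true 2 u s3 ([:: s1; s2] ++ W),
      ~~ joined c true 2 s3 s6 ([:: s4; s5] ++ W)
    & ~~ joined c true 3 u s6 ([:: s1; s2; s3; s4; s5] ++ W)].

Lemma window_sub u s1 s2 s3 s4 s5 s6 W ws :
  uniq ws -> {subset ws <= W} ->
  window u s1 s2 s3 s4 s5 s6 W -> window u s1 s2 s3 s4 s5 s6 ws.
Proof.
move=> uws sub /and5P[uW h n2 n2' n3].
have nj k v v' A : ~~ joined c true k v v' (A ++ W) ->
    ~~ joined c true k v v' (A ++ ws).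
  apply: contra; apply: joined_sub => t; rewrite !mem_cat.
  by case/orP=> [->//|/sub ->]; rewrite orbT.
apply/and5P; split=> //; try exact: nj.
move: uW; rewrite !cat_uniq => /and3P[-> /hasPn dW _] /=; rewrite uws andbT.
by apply/hasPn=> t /sub /dW.
Qed.

(** Code 0 is [u], codes 1 to 6 are [s1] to [s6], and the outside vertices are numbered from 10. *)
Definition window_specs n : seq spec :=
  [:: (true, 2, 0, 3, [:: 1; 2] ++ iota 10 n);
      (true, 2, 3, 6, [:: 4; 5] ++ iota 10 n);
      (true, 3, 0, 6, [:: 1; 2; 3; 4; 5] ++ iota 10 n)].

Lemma map_vertex_iota x0 (vs ws : seq T) :
  map (vertex x0 vs ws) (iota 10 (size ws)) = ws.
Proof.
apply: (@eq_from_nth _ x0); rewrite size_map size_iota // => i iw.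
by rewrite (nth_map 0) ?size_iota // nth_iota // /vertex /= addKn.
Qed.

(** A path of two edges has five inner vertices. [near] takes five out of six and spares the joint
    [s6]; [far] uses all of its five and spares both [u] and [s5]. *)
Definition near u s1 s2 s3 s4 s5 x y := joined c false 2 x y [:: u; s1; s2; s3; s4; s5].
Definition far s1 s2 s3 s4 s6 x y := joined c false 2 x y [:: s1; s2; s3; s4; s6].

(** Refutes the conjunction of three assumptions: no red path lengthens the window, the pairs at the
    positions in [E] have no near path, and the pair at positions [i], [j] has no far path. *)
Lemma window_certificate u s1 s2 s3 s4 s5 s6 ws (E : seq (nat * nat)) i j t :
  window u s1 s2 s3 s4 s5 s6 ws ->
  all (fun e => ~~ near u s1 s2 s3 s4 s5 (nth u ws e.1) (nth u ws e.2)) E ->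
  contradictory 7 (size ws)
    (window_specs (size ws) ++ (false, 2, 10 + i, 10 + j, [:: 1; 2; 3; 4; 6]) ::
     [seq (false, 2, 10 + e.1, 10 + e.2, iota 0 6) | e <- E])
    [:: ([:: 3; 4; 5; 6], true)] t ->
  far s1 s2 s3 s4 s6 (nth u ws i) (nth u ws j).
Proof.
move=> /and5P[uW h n2 n2' n3] deadE ct; apply: contraT => nfar; exfalso.
apply: (contradiction (x0 := u) (c := c) uW _ _ ct); last by rewrite /= andbT; apply/eqP.
have vW k : vertex u [:: u; s1; s2; s3; s4; s5; s6] ws (10 + k) = nth u ws k.
  by rewrite /vertex ltnNge leq_addr /= addKn.
rewrite all_cat; apply/andP; split.
  by rewrite /holds /= map_vertex_iota n2 n2' n3.
rewrite [all _ _]/= vW; apply/andP; split; first by rewrite vW; exact: nfar.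
rewrite all_map; apply: sub_all deadE => e /=.
by rewrite !vW.
Qed.

Variables (u s1 s2 s3 s4 s5 s6 : T) (W : seq T).
Hypothesis win : window u s1 s2 s3 s4 s5 s6 W.

Definition dead x y := [&& x \in W, y \in W, x != y & ~~ near u s1 s2 s3 s4 s5 x y].
Let far' := far s1 s2 s3 s4 s6.

Lemma dead_sym : symmetric dead.
Proof.
by move=> x y; rewrite /dead /near joinedC // eq_sym andbCA.
Qed.

Lemma dead_irr : irreflexive dead.
Proof. by move=> x; rewrite /dead eqxx !andbF. Qed.

Lemma window_certificate_on ws E i j t :
  uniq ws -> all (mem W) ws ->
  all (fun e => dead (nth u ws e.1) (nth u ws e.2)) E ->
  contradictory 7 (size ws)
    (window_specs (size ws) ++ (false, 2, 10 + i, 10 + j, [:: 1; 2; 3; 4; 6]) ::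
     [seq (false, 2, 10 + e.1, 10 + e.2, iota 0 6) | e <- E])
    [:: ([:: 3; 4; 5; 6], true)] t ->
  far' (nth u ws i) (nth u ws j).
Proof.
move=> uws /allP sub deadE; apply: window_certificate.
  exact: window_sub uws sub win.
by apply: sub_all deadE => e /and4P[].
Qed.

(** The digits in such a name are the positions in [ws] of the pair to be joined. There is one lemma
    for each type of pair under the symmetries of the configuration; positions beyond the
    configuration hold arbitrary further vertices of W. *)
Lemma far_K4_01 a b d e : conf_K4 dead a b d e -> uniq [:: a; b; d; e] ->
  all (mem W) [:: a; b; d; e] -> far' a b.
Proof.
move=> /andP[_ dd] uws sub.
apply: (window_certificate_on (ws := [:: a; b; d; e])
  (E := [:: (0, 1); (0, 2); (0, 3); (1, 2); (1, 3); (2, 3)])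
  (i := 0) (j := 1) (t := "02b15d43a6 02d15c43b6 03a25c14b6 03b15d24a6 03c25d14b6 04b15c23a6
04b15d32a6 05a32c41b6 05a34c21b6 05c14b32a6 05c21b34a6 05d34a12b6
05d34c21a6 05d43b12a6 a03512c a03514c a12634b a14302c a23045d a23614b
a26134b a26413b a34105c a34125d a34612b a35012d a35014b b01234c b01324c
b14025c b14305d b23105c c02513d c23415d c24305d")) ; [by []|by []| |by vm_compute].
by rewrite /= ?andbT.
Qed.

Lemma far_K4_04 a b d e x : conf_K4 dead a b d e -> uniq [:: a; b; d; e; x] ->
  all (mem W) [:: a; b; d; e; x] -> far' a x.
Proof.
move=> /andP[_ dd] uws sub.
apply: (window_certificate_on (ws := [:: a; b; d; e; x])
  (E := [:: (0, 1); (0, 2); (0, 3); (1, 2); (1, 3); (2, 3)])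
  (i := 0) (j := 4) (t := "03b15d24e6 03c25d14a6 04b25d13a6 04c25b13a6 05a41d32e6 05a42b31e6
05b14c32a6 05b31e42a6 05b32d14e6 05b43c12a6 05c21d43e6 05d43e21a6
a04512b a04512d a12634e a13624e a14623e a16324e a23614e a24613e a26134e
b02413c b03124d b03512d b04512d b13025c b13045d b15024c b15203c b25134d
b34215d b35024c c04213d c34125d")) ; [by []|by []| |by vm_compute].
by rewrite /= ?andbT.
Qed.

Lemma far_K4_45 a b d e x y : conf_K4 dead a b d e -> uniq [:: a; b; d; e; x; y] ->
  all (mem W) [:: a; b; d; e; x; y] -> far' x y.
Proof.
move=> /andP[_ dd] uws sub.
apply: (window_certificate_on (ws := [:: a; b; d; e; x; y])
  (E := [:: (0, 1); (0, 2); (0, 3); (1, 2); (1, 3); (2, 3)])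
  (i := 4) (j := 5) (t := "02c15a34f6 02d15b43f6 03d15a24f6 03d25a41f6 04c35d21e6 04d25a31e6
05a21f34e6 05a31b42e6 05a34b12f6 05a43f21e6 05b24c31e6 05b42c13f6
05b43c21e6 05d41f32e6 a03514b a05214c a05324c a05413b a12504b a13504b
a25314b a25413b a35012d b04523d b05423c b13402d b13405d b14302d b25034c
b45012c b45013d e12634f e13624f e16324f e23614f e24613f e26134f e34612f
e46213f")) ; [by []|by []| |by vm_compute].
by rewrite /= ?andbT.
Qed.

Lemma far_C5_01 a b d e f : conf_C5 dead a b d e f -> uniq [:: a; b; d; e; f] ->
  all (mem W) [:: a; b; d; e; f] -> far' a b.
Proof.
move=> /andP[_ dd] uws sub.
apply: (window_certificate_on (ws := [:: a; b; d; e; f])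
  (E := [:: (0, 1); (1, 2); (2, 3); (3, 4); (4, 0)])
  (i := 0) (j := 1) (t := "03b25d41a6 03d15c42a6 04a35d21b6 04d25a13b6 04e15c32a6 04e15d23b6
04e25c13a6 05c13e42b6 05c41e32b6 05d12b34a6 05d13e24a6 05d21b34a6
05d31e42b6 05d32a14b6 05d32e41a6 05d34a12b6 a13246b a13426b a13624b
a14623b a23614b a24613b a34612b a46123b a46213b b23015c b23145c c01524d
c04512d c12503d c13502d d01324e d02413e d05134e d05314e d25014e d25314e
d35014e d35024e e12304a e34125a")) ; [by []|by []| |by vm_compute].
by rewrite /= ?andbT.
Qed.

Lemma far_C5_02 a b d e f : conf_C5 dead a b d e f -> uniq [:: a; b; d; e; f] ->
  all (mem W) [:: a; b; d; e; f] -> far' a d.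
Proof.
move=> /andP[_ dd] uws sub.
apply: (window_certificate_on (ws := [:: a; b; d; e; f])
  (E := [:: (0, 1); (1, 2); (2, 3); (3, 4); (4, 0)])
  (i := 0) (j := 2) (t := "02e15c34a6 03b15e42c6 03c15d42a6 03c25e14a6 03d15b42a6 04a15e23c6
04b35d21a6 05b24c31a6 05b34e12c6 05b42c13a6 05c21d43a6 05c21e34a6
05d42a31c6 05d43a21c6 a13624c a14035b a14623c a16234c a23405b a24301b
a24613c a34612c b03412c b05214c b14502c c03124d c13504d c14235d c23045d
c25013d d04512e d05413e d45012e d45123e e15423a")) ; [by []|by []| |by vm_compute].
by rewrite /= ?andbT.
Qed.

Lemma far_C5_05 a b d e f x : conf_C5 dead a b d e f -> uniq [:: a; b; d; e; f; x] ->
  all (mem W) [:: a; b; d; e; f; x] -> far' a x.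
Proof.
move=> /andP[_ dd] uws sub.
apply: (window_certificate_on (ws := [:: a; b; d; e; f; x])
  (E := [:: (0, 1); (1, 2); (2, 3); (3, 4); (4, 0)])
  (i := 0) (j := 5) (t := "02a15b34f6 02c15d43a6 03b15d24a6 03c15e42f6 04a35e12f6 04c35b12a6
05b42e13a6 05c41f32a6 05c42e31a6 05c43a21f6 05d21f43a6 05d24a31f6
05d34b12a6 05e23b14f6 a04312b a12045b a12634f a13624f a23416f a24613f
a26134f a34216f a34612f a36124f a36214f b13045c b13504c b34102c c04512d
c13025d c34025d d02514e d05214e d05234e d05324e d15423e e05234a e15324a")) ; [by []|by []| |by vm_compute].
by rewrite /= ?andbT.
Qed.

Lemma far_C5_56 a b d e f x y : conf_C5 dead a b d e f -> uniq [:: a; b; d; e; f; x; y] ->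
  all (mem W) [:: a; b; d; e; f; x; y] -> far' x y.
Proof.
move=> /andP[_ dd] uws sub.
apply: (window_certificate_on (ws := [:: a; b; d; e; f; x; y])
  (E := [:: (0, 1); (1, 2); (2, 3); (3, 4); (4, 0)])
  (i := 5) (j := 6) (t := "02a15d43f6 02d15b34f6 02e15b43f6 03b15e42g6 03e15c42g6 04e15b32g6
04e15c32f6 04e25b13f6 05a24d31f6 05a34d21g6 05c21e34f6 05c32d14f6
05c43e21g6 05e31f42g6 05e42g13f6 a02513b a03512b a03514b b13045c c05213d
c15324d c15423d c35012d d14503e d23401e d23405e d24301e e12035a e13205a
e14025a e14503a e24035a e24305a e35012a f13624g f14623g f34126g f34612g
f36214g")) ; [by []|by []| |by vm_compute].
by rewrite /= ?andbT.
Qed.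

(** For this configuration only pairs that avoid the isolated edge are treated; [a] and [b] become
    exceptional vertices in [window_dichotomy]. *)
Lemma far_K2K3_23 a b d e f : conf_K2K3 dead a b d e f -> uniq [:: a; b; d; e; f] ->
  all (mem W) [:: a; b; d; e; f] -> far' d e.
Proof.
move=> /andP[_ dd] uws sub.
apply: (window_certificate_on (ws := [:: a; b; d; e; f])
  (E := [:: (0, 1); (2, 3); (3, 4); (2, 4)])
  (i := 2) (j := 3) (t := "02a15e34d6 02b15d43c6 04a25e31c6 04c35a12d6 04d15a32c6 04e35d12c6
05b32e14d6 05b41d23c6 05c21b43d6 05c23a41d6 05c23e14d6 05d34b21c6
05d41a23c6 05e21b34c6 05e24a31c6 05e31c42d6 a04213b a12035b a12405b
a13504b a15324b a23405b a34201b a35124b c02513d c02513e c04312e c05213e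
c12634d c13405d c13624d c23614d c25034e c34612d c36124d c36412d d05312e
d14025e d14035e d14205e d14235e d45123e")) ; [by []|by []| |by vm_compute].
by rewrite /= ?andbT.
Qed.

Lemma far_K2K3_25 a b d e f x : conf_K2K3 dead a b d e f -> uniq [:: a; b; d; e; f; x] ->
  all (mem W) [:: a; b; d; e; f; x] -> far' d x.
Proof.
move=> /andP[_ dd] uws sub.
apply: (window_certificate_on (ws := [:: a; b; d; e; f; x])
  (E := [:: (0, 1); (2, 3); (3, 4); (2, 4)])
  (i := 2) (j := 5) (t := "02c15e43f6 02e15d34f6 03a25d14c6 03b15e42c6 03d25c41f6 04c25d13f6
04e35b12c6 05a42c31f6 05a43e21c6 05c24d13f6 05c42b31f6 05c43e12f6
05d13f24c6 05d14b23c6 05d31e42c6 05d34e12c6 a03214b a04513b a05423b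
a45013b c02413e c04513d c12035d c12634f c23614f c24613f c25034e c25413e
c34216f c45012e c46123f d02314e d03514e d05134e d05324e d12403e d25134e")) ; [by []|by []| |by vm_compute].
by rewrite /= ?andbT.
Qed.

Lemma far_K2K3_56 a b d e f x y : conf_K2K3 dead a b d e f -> uniq [:: a; b; d; e; f; x; y] ->
  all (mem W) [:: a; b; d; e; f; x; y] -> far' x y.
Proof.
move=> /andP[_ dd] uws sub.
apply: (window_certificate_on (ws := [:: a; b; d; e; f; x; y])
  (E := [:: (0, 1); (2, 3); (3, 4); (2, 4)])
  (i := 5) (j := 6) (t := "03c15e42f6 03d15e24g6 03e15d42f6 04c25e13g6 04d25e13g6 05c21g43f6
05c32e14f6 05c32f14g6 05c41d32f6 05d14c32g6 05d24c31f6 05d31c42g6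
05d43c21g6 c03145d c03512e c04512e c13402d c23415e c24015d c24301e
c25013e c34125e c35024d d02514e d03145e d03512e d04213e d25013e d34125e
d45013e f13246g f13624g f14623g f23614g f24613g f34612g f36124g")) ; [by []|by []| |by vm_compute].
by rewrite /= ?andbT.
Qed.

Lemma far_3K2_01 a b d e f g : conf_3K2 dead a b d e f g -> uniq [:: a; b; d; e; f; g] ->
  all (mem W) [:: a; b; d; e; f; g] -> far' a b.
Proof.
move=> /andP[_ dd] uws sub.
apply: (window_certificate_on (ws := [:: a; b; d; e; f; g])
  (E := [:: (0, 1); (2, 3); (4, 5)])
  (i := 0) (j := 1) (t := "02f15e43a6 03d25e14a6 03f15c24a6 04b15e23a6 04c25f13b6 04d25f13b6
04e15a32b6 04e15d32b6 04f15e23b6 05c13e42a6 05c42a31b6 05d31b24a6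
05d32c14b6 05d34e21b6 05e21f34a6 05e32c14b6 05e34a21b6 05f24a31b6
05f32d41a6 05f34e21b6 05f42a13b6 a14236b a14623b a23416b a23614b a24316b
a24613b a34216b a34612b a35104b a46123b c04513d c12305d c12503d c13204d
c15023d c15203d c15234d c24035d c45023d e03512f e04123f e12503f e12504f
e14025f e14305f e24301f e25014f e25103f e34102f e34215f e35014f e45103f")) ; [by []|by []| |by vm_compute].
by rewrite /= ?andbT.
Qed.

Lemma far_3K2_02 a b d e f g : conf_3K2 dead a b d e f g -> uniq [:: a; b; d; e; f; g] ->
  all (mem W) [:: a; b; d; e; f; g] -> far' a d.
Proof.
move=> /andP[_ dd] uws sub.
apply: (window_certificate_on (ws := [:: a; b; d; e; f; g])
  (E := [:: (0, 1); (2, 3); (4, 5)])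
  (i := 0) (j := 2) (t := "02e15d34a6 02f15d34a6 03b25f14c6 03e25b14c6 03f15d24c6 04c15f23a6
04c25f13a6 04c25f31a6 04f25c13a6 05a13f24c6 05a32e41c6 05d14c23a6
05d21c34a6 05d32c14a6 05d42f13a6 05e12c43a6 05e13a42c6 05e14a32c6
05e32f41a6 05e41c23a6 a03512b a13624c a14302b a14623c a15023b a23614c
a36412c a46123c a46312c c04125d c12504d c14205d c24015d c24035d c24135d
e01234f e03215f e04512f e04523f e05123f e05124f e15024f e34215f e35012f
e45013f")) ; [by []|by []| |by vm_compute].
by rewrite /= ?andbT.
Qed.

Lemma far_3K2_06 a b d e f g x : conf_3K2 dead a b d e f g -> uniq [:: a; b; d; e; f; g; x] ->
  all (mem W) [:: a; b; d; e; f; g; x] -> far' a x.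
Proof.
move=> /andP[_ dd] uws sub.
apply: (window_certificate_on (ws := [:: a; b; d; e; f; g; x])
  (E := [:: (0, 1); (2, 3); (4, 5)])
  (i := 0) (j := 6) (t := "02b15d43a6 02f15d43a6 03d15a42g6 03d25c41a6 03f25e14g6 04c15e23a6
04d35c12g6 05b34d21g6 05b42c13g6 05c21g34a6 05c23d14a6 05c23f14a6
05c43a21g6 05d34a21g6 05e13c42a6 05e42d13a6 05e43a12g6 05f43a21g6
a13624g a14305b a23405b a23614g a24305b a24316g a34126g a34216g a34612g
a45102b a46123g a46213g c02514d c05214d c05423d c12403d c14035d c14302d
c15324d c25013d c45213d e05123f e12504f e45012f e45023f")) ; [by []|by []| |by vm_compute].
by rewrite /= ?andbT.
Qed.

Lemma far_3K2_67 a b d e f g x y : conf_3K2 dead a b d e f g -> uniq [:: a; b; d; e; f; g; x;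
  y] ->
  all (mem W) [:: a; b; d; e; f; g; x; y] -> far' x y.
Proof.
move=> /andP[_ dd] uws sub.
apply: (window_certificate_on (ws := [:: a; b; d; e; f; g; x; y])
  (E := [:: (0, 1); (2, 3); (4, 5)])
  (i := 6) (j := 7) (t := "03b15c24g6 03b25c41g6 03c25e14g6 03d15a24g6 03e15a24h6 03e15c42g6
04b15d32h6 04f25a13h6 04f25c13g6 05a43f21h6 05b32d14g6 05b41c23h6
05e14g32h6 05e24d13h6 05e32f41g6 05f21h43g6 a12503b a12504b a15203b
a25104b a45013b c03214d c24135d c25103d c45103d c45213d e01324f e05234f
e13024f e13025f e15024f e15204f e35024f g13426h g14623h g24613h g34612h
g36124h")) ; [by []|by []| |by vm_compute].
by rewrite /= ?andbT.
Qed.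

End LocalLemmas.
Arguments dead : simpl never.

(** * Certificates for the path that closes the blue cycle *)

Section Closing.
Variables (T : finType) (c : {set T} -> bool).

(** The certificate starts from no known colour, so [u] may be a carried vertex and the edge
    [u s1 s2 s3] may be blue. *)
Lemma one_edge u s1 s2 s3 x z p q :
  uniq ([:: u; s1; s2; s3] ++ [:: x; z; p; q]) ->
  ~~ joined c true 2 u s3 [:: s1; s2; x; z; p; q] ->
  joined c false 2 x z [:: u; s1; s2; s3; p; q].
Proof.
move=> uW n2; apply: contraT => nj; exfalso.
apply: (@contradiction _ c u _ _ uW
  [:: (true, 2, 0, 3, [:: 1; 2; 10; 11; 12; 13]);
      (false, 2, 10, 11, [:: 0; 1; 2; 3; 12; 13])] [::] "01cb2d3 02bc1a3 02da1c3 0ad12b3 0bcd1a3 a0d213b a13c0db a1c32db a1d02cb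
a3d10cb"); last by vm_compute.
  by rewrite /= n2 nj.
by [].
Qed.

(** Closes the cycle over a whole window both of whose ends are available. The red edge comes from
    [close_even]: were it blue, it would close the cycle by itself. *)
Lemma three_paths u s1 s2 s3 s4 s5 s6 x z y p q :
  window c u s1 s2 s3 s4 s5 s6 [:: x; z; y; p; q] -> hue c [:: z; y; p; q] ->
  joined c false 3 x z [:: u; s1; s2; s3; s4; s5; s6; y; p; q].
Proof.
move=> /and5P[uW h n2 n2' n3] hW; apply: contraT => nj; exfalso.
apply: (@contradiction _ c u _ _ uW
  ((false, 3, 10, 11, [:: 0; 1; 2; 3; 4; 5; 6; 12; 13; 14]) :: window_specs 5)
  [:: ([:: 3; 4; 5; 6], true); ([:: 11; 12; 13; 14], true)] "012bcd3 01bc2d3 01eb2d3 02b1ae5346 02ed1b3 0341cdb2e6 04c25a31b6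
04d35e1bc6 0ac12b3 0ac1de4356 0ad21b3 0ae21b3 0bc12a3 0bc12e3 0bc1de4356
0bd12e3 0cd12b3 0ce12b3 0de21b3 345eac6 34ca5d6 34cd5a6 34da5e6 35a4bc6
35c4ad6 35e4ad6 35ea4d6 3ae4bc6 3bc45a6 3bc4ad6 3ce45a6 3ce45d6 3ce4bd6
a1c02ed46b a231de46cb a2d0ce136b a2e01dc34b a352de01cb a4532e1cdb
a453cd26eb a4c35e10db a4d32e10cb a4e3cd201b a564ce32db a564de123b
a5e1043cdb a5e34d01cb a5e34dc16b a6d42c01eb a6d45e312b a6d4ce312b
a6d54e312b a6e54c312b ace645d13b"); last by vm_compute.
  by rewrite /= n2 n2' n3 nj.
by rewrite /= h hW.
Qed.

(** Here the closing path has to spare [s3], already used by the first window. If no such path joins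
    [x] to [z], far paths are forced between the other vertices of W. This lemma and the next two
    treat pairs with two, one or no vertex among [p], [q], [r]. *)
Lemma far_T1L_23 u s1 s2 s3 s4 s5 s6 x z p q r  :
  window c u s1 s2 s3 s4 s5 s6 [:: x; z; p; q; r] -> hue c [:: u; s1; s2; s3] ->
  ~~ joined c false 2 x z [:: u; s1; s2; p; q; r] -> far c s1 s2 s3 s4 s6 p q.
Proof.
move=> /and5P[uW h n2 n2' n3] h0 nj; apply: contraT => nfar; exfalso.
apply: (@contradiction _ c u _ _ uW
  [:: (false, 2, 10, 11, [:: 0; 1; 2; 12; 13; 14]),
      (false, 2, 12, 13, [:: 1; 2; 3; 4; 6]) & window_specs 5]
  [:: ([:: 3; 4; 5; 6], true); ([:: 0; 1; 2; 3], true)] "012adec346 02eb1dc346 0ac12d3 0ad1bec346 0bc1ae24d6 0be21c3 0be21d3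
0be2ad14c6 a021ceb a1c02eb a1d02eb a2d10cb a2e1cdb acde02b c13246d
c46123d c46312d"); last by vm_compute.
  by rewrite /= n2 n2' n3 nj; move: nfar; rewrite /far => ->.
by rewrite /= h h0.
Qed.

Lemma far_T1L_25 u s1 s2 s3 s4 s5 s6 x z p q r a :
  window c u s1 s2 s3 s4 s5 s6 [:: x; z; p; q; r; a] -> hue c [:: u; s1; s2; s3] ->
  ~~ joined c false 2 x z [:: u; s1; s2; p; q; r] -> far c s1 s2 s3 s4 s6 p a.
Proof.
move=> /and5P[uW h n2 n2' n3] h0 nj; apply: contraT => nfar; exfalso.
apply: (@contradiction _ c u _ _ uW
  [:: (false, 2, 10, 11, [:: 0; 1; 2; 12; 13; 14]),
      (false, 2, 12, 15, [:: 1; 2; 3; 4; 6]) & window_specs 6]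
  [:: ([:: 3; 4; 5; 6], true); ([:: 0; 1; 2; 3], true)] "012adec346 02cade14f6 0ad2bc14f6 0ae21f3 0bdc123 0be2ad14c6 0cdb2e14f6
a0c21eb a0d21eb a120cdb a12d0cb a2e0cdb acde02b ade12cb c23146f c46123f
c46312f"); last by vm_compute.
  by rewrite /= n2 n2' n3 nj; move: nfar; rewrite /far => ->.
by rewrite /= h h0.
Qed.

Lemma far_T1L_56 u s1 s2 s3 s4 s5 s6 x z p q r a b :
  window c u s1 s2 s3 s4 s5 s6 [:: x; z; p; q; r; a; b] -> hue c [:: u; s1; s2; s3] ->
  ~~ joined c false 2 x z [:: u; s1; s2; p; q; r] -> far c s1 s2 s3 s4 s6 a b.
Proof.
move=> /and5P[uW h n2 n2' n3] h0 nj; apply: contraT => nfar; exfalso.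
apply: (@contradiction _ c u _ _ uW
  [:: (false, 2, 10, 11, [:: 0; 1; 2; 12; 13; 14]),
      (false, 2, 15, 16, [:: 1; 2; 3; 4; 6]) & window_specs 7]
  [:: ([:: 3; 4; 5; 6], true); ([:: 0; 1; 2; 3], true)] "01eacd24g6 0ac2be14f6 0ad12f3 0ad1be24g6 0ad2bc14g6 0bc21g3 0deb2c14f6
a0d12cb a0d12eb a0d21eb a0e12cb a1d02cb a2c0deb acd21eb f13246g f23146g
f46123g"); last by vm_compute.
  by rewrite /= n2 n2' n3 nj; move: nfar; rewrite /far => ->.
by rewrite /= h h0.
Qed.

(** The analogue for a closing path of three edges, which has to spare [v6]. The far paths are
    forced one edge further on, in the window from [v3] to [v9]; hence ten vertices of the cycle and
    the exclusion of four red edges in place of three. *)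
Lemma far_TL_23 v0 v1 v2 v3 v4 v5 v6 v7 v8 v9 x z y p q  :
  let ws := [:: x; z; y; p; q] in
  uniq ([:: v0; v1; v2; v3; v4; v5; v6; v7; v8; v9] ++ ws) ->
  hue c [:: v0; v1; v2; v3] ->
  window c v0 v1 v2 v3 v4 v5 v6 ws -> window c v3 v4 v5 v6 v7 v8 v9 ws ->
  ~~ joined c true 4 v0 v9 ([:: v1; v2; v3; v4; v5; v6; v7; v8] ++ ws) ->
  hue c [:: z; y; p; q] ->
  ~~ joined c false 3 x z [:: v0; v1; v2; v3; v4; v5; y; p; q] ->
  far c v4 v5 v6 v7 v9 y p.
Proof.
move=> ws uW h0 /and5P[_ h1 n03 n36 n06] /and5P[_ h2 _ n69 n39] n09 hW nj.
apply: contraT => nfar; exfalso.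
apply: (@contradiction _ c v0 _ _ uW
  ([:: (false, 3, 10, 11, [:: 0; 1; 2; 3; 4; 5; 12; 13; 14]);
       (false, 2, 12, 13, [:: 4; 5; 6; 7; 9]);
       (true, 2, 6, 9, [:: 7; 8] ++ iota 10 5);
       (true, 3, 3, 9, [:: 4; 5; 6; 7; 8] ++ iota 10 5);
       (true, 4, 0, 9, [:: 1; 2; 3; 4; 5; 6; 7; 8] ++ iota 10 5)]
     ++ window_specs 5)
  [:: ([:: 3; 4; 5; 6], true); ([:: 0; 1; 2; 3], true);
      ([:: 6; 7; 8; 9], true); ([:: 11; 12; 13; 14], true)] "013cbed456 01bcae3 01deac3 0231ae54d6 02bd1a3 02db1e4356 0ac21e3
0bd21c5346 0bd2ac3 0be21d5346 345dbec679 34adbec579 3bd5aec679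
a2c01ed35b a3c25d14eb a3d15c20eb a4d32e10cb a5e13c02db ace345d02b
ace534d02b c79546d c79645d"); last by vm_compute.
  by rewrite /= n03 n36 n06 n69 n39 n09 nj; move: nfar; rewrite /far => ->.
by rewrite /= h0 h1 h2 hW.
Qed.

Lemma far_TL_25 v0 v1 v2 v3 v4 v5 v6 v7 v8 v9 x z y p q a :
  let ws := [:: x; z; y; p; q; a] in
  uniq ([:: v0; v1; v2; v3; v4; v5; v6; v7; v8; v9] ++ ws) ->
  hue c [:: v0; v1; v2; v3] ->
  window c v0 v1 v2 v3 v4 v5 v6 ws -> window c v3 v4 v5 v6 v7 v8 v9 ws ->
  ~~ joined c true 4 v0 v9 ([:: v1; v2; v3; v4; v5; v6; v7; v8] ++ ws) ->
  hue c [:: z; y; p; q] ->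
  ~~ joined c false 3 x z [:: v0; v1; v2; v3; v4; v5; y; p; q] ->
  far c v4 v5 v6 v7 v9 y a.
Proof.
move=> ws uW h0 /and5P[_ h1 n03 n36 n06] /and5P[_ h2 _ n69 n39] n09 hW nj.
apply: contraT => nfar; exfalso.
apply: (@contradiction _ c v0 _ _ uW
  ([:: (false, 3, 10, 11, [:: 0; 1; 2; 3; 4; 5; 12; 13; 14]);
       (false, 2, 12, 15, [:: 4; 5; 6; 7; 9]);
       (true, 2, 6, 9, [:: 7; 8] ++ iota 10 6);
       (true, 3, 3, 9, [:: 4; 5; 6; 7; 8] ++ iota 10 6);
       (true, 4, 0, 9, [:: 1; 2; 3; 4; 5; 6; 7; 8] ++ iota 10 6)]
     ++ window_specs 6)
  [:: ([:: 3; 4; 5; 6], true); ([:: 0; 1; 2; 3], true);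
      ([:: 6; 7; 8; 9], true); ([:: 11; 12; 13; 14], true)] "01d2ae3 01d2ce4356 02cd1a3 02d1bc4356 02d1bc5346 02d1ce4356 02db1c3
02e1bc4356 0ace123 0aec2b3 0bc2ad3 0bd2ae5346 0cea1d4356 0cea2d5346
345dbec679 3bd45f6 3bd4aec679 a3d14ec02b a3d24ec15b a3e20dc14b
a4d10e23cb a5d23e14cb a5e20d13cb ace012d34b ace435d02b c79645f"); last by vm_compute.
  by rewrite /= n03 n36 n06 n69 n39 n09 nj; move: nfar; rewrite /far => ->.
by rewrite /= h0 h1 h2 hW.
Qed.

Lemma far_TL_56 v0 v1 v2 v3 v4 v5 v6 v7 v8 v9 x z y p q a b :
  let ws := [:: x; z; y; p; q; a; b] in
  uniq ([:: v0; v1; v2; v3; v4; v5; v6; v7; v8; v9] ++ ws) ->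
  hue c [:: v0; v1; v2; v3] ->
  window c v0 v1 v2 v3 v4 v5 v6 ws -> window c v3 v4 v5 v6 v7 v8 v9 ws ->
  ~~ joined c true 4 v0 v9 ([:: v1; v2; v3; v4; v5; v6; v7; v8] ++ ws) ->
  hue c [:: z; y; p; q] ->
  ~~ joined c false 3 x z [:: v0; v1; v2; v3; v4; v5; y; p; q] ->
  far c v4 v5 v6 v7 v9 a b.
Proof.
move=> ws uW h0 /and5P[_ h1 n03 n36 n06] /and5P[_ h2 _ n69 n39] n09 hW nj.
apply: contraT => nfar; exfalso.
apply: (@contradiction _ c v0 _ _ uW
  ([:: (false, 3, 10, 11, [:: 0; 1; 2; 3; 4; 5; 12; 13; 14]);
       (false, 2, 15, 16, [:: 4; 5; 6; 7; 9]);
       (true, 2, 6, 9, [:: 7; 8] ++ iota 10 7);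
       (true, 3, 3, 9, [:: 4; 5; 6; 7; 8] ++ iota 10 7);
       (true, 4, 0, 9, [:: 1; 2; 3; 4; 5; 6; 7; 8] ++ iota 10 7)]
     ++ window_specs 7)
  [:: ([:: 3; 4; 5; 6], true); ([:: 0; 1; 2; 3], true);
      ([:: 6; 7; 8; 9], true); ([:: 11; 12; 13; 14], true)] "01bd2c3 01c2ad3 01c2ae3 01cb2e5346 0231bc54f6 02bc1a3 02c1bd4356 02cd1a3
0ade123 0ae21b3 0bc12d4356 0bc12e5346 0bc1ad3 0bd21c3 0cd12b3 0cd21e4356
0cd2be5346 0ceb123 35dace47g9 35dcae47g9 3ac45f6 3ad4bc57g9 3ae45f6
3bc4ae57g9 3bd4ac57g9 3de4bc57g9 3de54f6 a2e01cd34b a2e01dc45b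
a3c14d25eb a3d10c25eb a3d15e20cb a3d24e10cb a3e20cd14b a4c35ed01b
a4d312c0eb a4e32dc15b a4e5cd312b a4ec0d213b a5c43ed02b a5d32e10cb
ade012c34b f46579g f56479g"); last by vm_compute.
  by rewrite /= n03 n36 n06 n69 n39 n09 nj; move: nfar; rewrite /far => ->.
by rewrite /= h0 h1 h2 hW.
Qed.

End Closing.

(** * Near paths or far paths for almost all pairs *)

Ltac split_hyps :=
  repeat match goal with
  | H : is_true (_ && _) |- _ => case/andP: H => ? ?
  | H : is_true (uniq _) |- _ => progress (rewrite /= ?inE ?negb_or in H)
  | H : is_true (_ \notin _) |- _ => progress (rewrite ?inE ?negb_or in H)
  end.

Section WindowDichotomy.
Variables (T : finType) (c : {set T} -> bool).
Variables (u s1 s2 s3 s4 s5 s6 : T) (W : seq T).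
Hypothesis win : window c u s1 s2 s3 s4 s5 s6 W.

Let near' := near c u s1 s2 s3 s4 s5.
Let far' := far c s1 s2 s3 s4 s6.
Notation dead := (dead c u s1 s2 s3 s4 s5 W).

Let deadC : symmetric dead.
Proof. exact: dead_sym. Qed.

Let deadI : irreflexive dead.
Proof. exact: dead_irr. Qed.

Let dead_memL x y : dead x y -> x \in W.
Proof. by case/and4P. Qed.

Let dead_memR x y : dead x y -> y \in W.
Proof. by case/and4P. Qed.

Let farC x y : far' x y = far' y x.
Proof. by rewrite /far' /far joinedC. Qed.

Ltac arrange_conj :=
  match goal with
  | |- is_true (_ && _) => apply/andP; split; arrange_conj
  | |- _ => first [assumption | by rewrite eq_sym | by rewrite deadC
      | by apply: dead_memL; eassumption | by apply: dead_memR; eassumption | done]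
  end.
Ltac arrange :=
  rewrite /conf_K4 /conf_C5 /conf_K2K3 /conf_3K2 /= ?inE ?negb_or; arrange_conj.

(** Relabelling the configuration by one of its symmetries brings every pair to a certified
    position; the next three statements proceed in the same way. *)
Let far_K4 a b d e x y : conf_K4 dead a b d e ->
  x \in W -> y \in W -> x != y -> far' x y.
Proof.
move=> H xW yW xy.
have inQ v w a' b' d' e' : conf_K4 dead a' b' d' e' -> v = a' -> w \in W -> v != w ->
    far' v w.
  move=> H' -> wW vw; move: (H') => H''; rewrite /conf_K4 in H''; split_hyps.
  have [wb|?] := eqVneq w b'.
    by rewrite wb; apply: (far_K4_01 win H'); arrange.
  have [wd|?] := eqVneq w d'.
    by rewrite wd; apply: (far_K4_01 win (_ : conf_K4 dead a' d' b' e')); arrange.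
  have [we|?] := eqVneq w e'.
    by rewrite we; apply: (far_K4_01 win (_ : conf_K4 dead a' e' b' d')); arrange.
  by apply: (far_K4_04 win H'); arrange.
have any v w : v \in [:: a; b; d; e] -> w \in W -> v != w -> far' v w.
  move: (H) => H'; rewrite /conf_K4 in H'; split_hyps.
  rewrite !inE => /or4P[] /eqP E.
  - exact: (inQ v w a b d e).
  - by apply: (inQ v w b a d e) => //; arrange.
  - by apply: (inQ v w d a b e) => //; arrange.
  - by apply: (inQ v w e a b d) => //; arrange.
have [xQ|xQ] := boolP (x \in [:: a; b; d; e]); first exact: any.
have [yQ|yQ] := boolP (y \in [:: a; b; d; e]).
  by rewrite farC; apply: any; rewrite // eq_sym.
move: (H) => H'; rewrite /conf_K4 in H'; split_hyps.
by apply: (far_K4_45 win H); arrange.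
Qed.

Let far_C5 a b d e f x y : conf_C5 dead a b d e f ->
  x \in W -> y \in W -> x != y -> far' x y.
Proof.
move=> H xW yW xy.
have inQ v w a' b' d' e' f' : conf_C5 dead a' b' d' e' f' -> v = a' -> w \in W -> v != w ->
    far' v w.
  move=> H' -> wW vw; move: (H') => H''; rewrite /conf_C5 in H''; split_hyps.
  have [wb|?] := eqVneq w b'.
    by rewrite wb; apply: (far_C5_01 win H'); arrange.
  have [wd|?] := eqVneq w d'.
    by rewrite wd; apply: (far_C5_02 win H'); arrange.
  have [we|?] := eqVneq w e'.
    (* The reflection of the pentagon that fixes [a'] exchanges [d'] with [e'] and [b'] with
       [f']. *)
    by rewrite we; apply: (far_C5_02 win (_ : conf_C5 dead a' f' e' d' b')); arrange.
  have [wf|?] := eqVneq w f'.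
    by rewrite wf; apply: (far_C5_01 win (_ : conf_C5 dead a' f' e' d' b')); arrange.
  by apply: (far_C5_05 win H'); arrange.
have any v w : v \in [:: a; b; d; e; f] -> w \in W -> v != w -> far' v w.
  move: (H) => H'; rewrite /conf_C5 in H'; split_hyps.
  rewrite !inE => /or4P[/eqP E|/eqP E|/eqP E|/orP[]/eqP E].
  - exact: (inQ v w a b d e f).
  - by apply: (inQ v w b d e f a) => //; arrange.
  - by apply: (inQ v w d e f a b) => //; arrange.
  - by apply: (inQ v w e f a b d) => //; arrange.
  - by apply: (inQ v w f a b d e) => //; arrange.
have [xQ|xQ] := boolP (x \in [:: a; b; d; e; f]); first exact: any.
have [yQ|yQ] := boolP (y \in [:: a; b; d; e; f]).
  by rewrite farC; apply: any; rewrite // eq_sym.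
move: (H) => H'; rewrite /conf_C5 in H'; split_hyps.
by apply: (far_C5_56 win H); arrange.
Qed.

Let far_K2K3 a b d e f x y : conf_K2K3 dead a b d e f ->
  x \in W -> y \in W -> x \notin [:: a; b] -> y \notin [:: a; b] -> x != y -> far' x y.
Proof.
move=> H xW yW xab yab xy.
have inQ v w d' e' f' : conf_K2K3 dead a b d' e' f' -> v = d' ->
    w \in W -> w \notin [:: a; b] -> v != w -> far' v w.
  move=> H' -> wW wab vw; move: (H') => H''; rewrite /conf_K2K3 in H''; split_hyps.
  have [we|?] := eqVneq w e'.
    by rewrite we; apply: (far_K2K3_23 win H'); arrange.
  have [wf|?] := eqVneq w f'.
    by rewrite wf; apply: (far_K2K3_23 win (_ : conf_K2K3 dead a b d' f' e')); arrange.
  by apply: (far_K2K3_25 win H'); arrange.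
have any v w : v \in [:: d; e; f] -> w \in W -> w \notin [:: a; b] -> v != w -> far' v w.
  move: (H) => H'; rewrite /conf_K2K3 in H'; split_hyps.
  move=> vQ wW wab vw; move: vQ; rewrite !inE => /or3P[] /eqP E.
  - exact: (inQ v w d e f).
  - by apply: (inQ v w e f d) => //; arrange.
  - by apply: (inQ v w f d e) => //; arrange.
have [xQ|xQ] := boolP (x \in [:: d; e; f]); first exact: any.
have [yQ|yQ] := boolP (y \in [:: d; e; f]).
  by rewrite farC; apply: any; rewrite // eq_sym.
move: (H) => H'; rewrite /conf_K2K3 in H'; split_hyps.
by apply: (far_K2K3_56 win H); arrange.
Qed.

Let far_3K2 a b d e f g x y : conf_3K2 dead a b d e f g ->
  x \in W -> y \in W -> x != y -> far' x y.
Proof.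
move=> H xW yW xy.
have inQ v w a' b' d' e' f' g' : conf_3K2 dead a' b' d' e' f' g' -> v = a' ->
    w \in W -> v != w -> far' v w.
  move=> H' -> wW vw; move: (H') => H''; rewrite /conf_3K2 in H''; split_hyps.
  have [wb|?] := eqVneq w b'.
    by rewrite wb; apply: (far_3K2_01 win H'); arrange.
  have [wd|?] := eqVneq w d'.
    by rewrite wd; apply: (far_3K2_02 win H'); arrange.
  have [we|?] := eqVneq w e'.
    by rewrite we; apply: (far_3K2_02 win (_ : conf_3K2 dead a' b' e' d' f' g')); arrange.
  have [wf|?] := eqVneq w f'.
    by rewrite wf; apply: (far_3K2_02 win (_ : conf_3K2 dead a' b' f' g' d' e')); arrange.
  have [wg|?] := eqVneq w g'.
    by rewrite wg; apply: (far_3K2_02 win (_ : conf_3K2 dead a' b' g' f' d' e')); arrange.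
  by apply: (far_3K2_06 win H'); arrange.
have any v w : v \in [:: a; b; d; e; f; g] -> w \in W -> v != w -> far' v w.
  move: (H) => H'; rewrite /conf_3K2 in H'; split_hyps.
  rewrite !inE => /or4P[/eqP E|/eqP E|/eqP E|/or3P[]/eqP E].
  - exact: (inQ v w a b d e f g).
  - by apply: (inQ v w b a d e f g) => //; arrange.
  - by apply: (inQ v w d e a b f g) => //; arrange.
  - by apply: (inQ v w e d a b f g) => //; arrange.
  - by apply: (inQ v w f g a b d e) => //; arrange.
  - by apply: (inQ v w g f a b d e) => //; arrange.
have [xQ|xQ] := boolP (x \in [:: a; b; d; e; f; g]); first exact: any.
have [yQ|yQ] := boolP (y \in [:: a; b; d; e; f; g]).
  by rewrite farC; apply: any; rewrite // eq_sym.
move: (H) => H'; rewrite /conf_3K2 in H'; split_hyps.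
by apply: (far_3K2_67 win H); arrange.
Qed.

Definition almost_all (R : rel T) := exists2 B : seq T, size B <= 2 &
  forall x y, x \in W -> y \in W -> x \notin B -> y \notin B -> x != y -> R x y.

(** A cover of size at most 2 of the graph of dead pairs is an exceptional set for near paths.
    Otherwise one of the four configurations consists of dead pairs and forces far paths, with
    exceptions only for a triangle and a disjoint edge. *)
Lemma window_dichotomy : almost_all near' \/ almost_all far'.
Proof.
case: (coverP deadC deadI)=> [B szB cov|a b d e H|a b d e f H|a b d e f H|a b d e f g H].
- left; exists B => // x y xW yW xB yB xy; apply: contraT => nxy.
  have D : dead x y by apply/and4P.
  by have := cov x y D; rewrite (negbTE xB) (negbTE yB).
- by right; exists [::] => // x y xW yW _ _; apply: far_K4 H xW yW.
- by right; exists [::] => // x y xW yW _ _; apply: far_C5 H xW yW.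
- by right; exists [:: a; b] => // x y; apply: far_K2K3 H.
- by right; exists [::] => // x y xW yW _ _; apply: far_3K2 H xW yW.
Qed.

End WindowDichotomy.

(** * Chains of windows *)

Section Cycles.
Variables (T : finType) (c : {set T} -> bool).
Implicit Types (l s A W : seq T) (x y u : T).

Definition closed b l := if l is x :: _ then lpath c b l x else true.

Definition cyc b n l := [&& size l == 3 * n, uniq l & closed b l].

Lemma cyc_rot b n k s : 3 * k <= size s -> cyc b n s -> cyc b n (rot (3 * k) s).
Proof.
move=> ks /and3P[/eqP szs us cs]; rewrite /cyc size_rot szs eqxx rot_uniq us /=.
have szl : size (take (3 * k) s) = 3 * k by rewrite size_take_min; apply/minn_idPl.
have szr : size (drop (3 * k) s) = 3 * (n - k) by rewrite size_drop szs mulnBr.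
move: cs; rewrite -{1}(cat_take_drop (3 * k) s) /rot.
move: (take _ s) (drop _ s) szl szr => l r szl szr.
case: l szl => [|x l] szl; first by rewrite cats0.
case: r szr => [|y r] szr; first by rewrite cats0.
rewrite /closed [(x :: l) ++ _]lock [(y :: r) ++ _]lock /= -!lock.
rewrite -[X in lpath _ _ X x -> _]/((x :: l) ++ (y :: r)).
by rewrite (lpath_cat _ _ _ _ szl) (lpath_cat _ _ _ _ szr) /= andbC.
Qed.

Variable m : nat.
Hypothesis nored : forall l, ~~ cyc true m.+1 l.

(** Replacing the first L edges by L + 1 red ones would give a red cycle with m + 1 edges. Redness
    is assumed only from [y] back to [x], so the replaced stretch may begin at a carried vertex. *)
Lemma no_shortcut L x l y s A :
  size (x :: l) = 3 * L -> size ((x :: l) ++ y :: s) = 3 * m ->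
  uniq ((x :: l) ++ y :: s) -> lpath c true (y :: s) x ->
  (forall t, t \in A -> t \notin y :: s) -> ~~ joined c true L.+1 x y A.
Proof.
move=> szl sz us ps As; apply/joinedP=> -[q [szq uq qA pq]].
have /negP := nored ((x :: q) ++ y :: s); apply; apply/and3P; split.
- by move: sz; rewrite !size_cat szl /= szq => ?; apply/eqP; lia.
- move: us; rewrite !cat_uniq => /and3P[_ /hasPn ds uys]; apply/and3P; split=> //.
    by move: uq; rewrite /= !inE negb_or => /and3P[/andP[_ ->] _ ->].
  apply/hasPn=> t ts; rewrite inE /= negb_or; apply/andP; split.
    by apply: contra (ds t ts) => /eqP->; rewrite inE eqxx.
  by apply/negP=> /qA /As; rewrite ts.
rewrite [_ ++ _]lock /= -lock.
rewrite -[closed _ _]/(lpath c true ((x :: q) ++ y :: s) x).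
by rewrite (@lpath_cat _ _ _ L.+1) /= ?szq ?pq ?ps //; lia.
Qed.

Lemma closed_rest L x l y s :
  cyc true m ((x :: l) ++ y :: s) -> size (x :: l) = 3 * L ->
  lpath c true (x :: l) y /\ lpath c true (y :: s) x.
Proof.
move=> /and3P[_ _ cs] szl; apply/andP.
by rewrite -[X in X && _]/(lpath c true (x :: l) (head x (y :: s))) -(lpath_cat _ _ _ _ szl).
Qed.

Lemma no_shortcut_joint L x l y s A :
  cyc true m ((x :: l) ++ y :: s) -> size (x :: l) = 3 * L ->
  (forall t, t \in A -> t \notin y :: s) -> ~~ joined c true L.+1 x y A.
Proof.
move=> cs szl As; have [_ ps] := closed_rest cs szl.
by case/and3P: cs => /eqP sz us _; apply: no_shortcut szl sz us ps As.
Qed.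

Lemma perm_swap_last (x u p a : T) l s :
  perm_eq ((u :: l) ++ s ++ [:: p; a; x]) ((x :: l) ++ s ++ [:: p; a; u]).
Proof.
by apply/permP=> P; rewrite /= !count_cat /=; lia.
Qed.

(* The edge before [x] contains [u], so it may be left at [u] instead of [x]. *)
Lemma no_shortcut_carry L x l y s p a u A :
  cyc true m ((x :: l) ++ y :: s ++ [:: p; a; u]) -> size (x :: l) = 3 * L ->
  (forall t, t \in A -> t \notin x :: y :: s ++ [:: p; a]) ->
  ~~ joined c true L.+1 u y A.
Proof.
move=> cs szl As; have [_ ps] := closed_rest cs szl.
case/and3P: cs => /eqP sz us _.
have pe := perm_swap_last x u p a l (y :: s).
(* Exchanging [u] and [x] in the list leaves the edge on [p], [a], [u], [x] unchanged as a set, so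
   the rest of the cycle is still red. *)
apply: (no_shortcut (l := l) (s := s ++ [:: p; a; x])) => //.
- by rewrite (perm_size pe).
- by rewrite (perm_uniq pe).
- have szs : size (y :: s) = 3 * (m - L.+1).
    by move: sz; rewrite !size_cat szl /= size_cat /= => ?; lia.
  move: ps; rewrite -cat_cons -[y :: s ++ [:: p; a;
    x]]cat_cons !(lpath_cat _ _ _ _ szs) /= !andbT.
  case/andP=> -> hu; rewrite (@hue_eq _ _ _ [:: p; a; u; x]) // => t.
  by rewrite !inE; case: (t == p); case: (t == a); case: (t == x); case: (t == u).
move=> t /As; rewrite !inE !mem_cat !inE !negb_or => /and3P[-> ->].
by case/and3P=> -> -> ->.
Qed.

End Cycles.

Ltac by_perm := clear; apply/permP=> ?; rewrite /= ?count_cat /= ?count_cat /=; lia.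

Section Chain.
Variables (T : finType) (c : {set T} -> bool) (m : nat) (W : seq T).
Hypothesis nored : forall l, ~~ cyc c true m.+1 l.
Hypothesis uW : uniq W.
Implicit Types (l s A : seq T) (x y u : T).

Definition outside s := forall t, t \in W -> t \notin s.

Lemma avoidW s l1 l2 A : uniq s -> outside s -> perm_eq s (l1 ++ l2) ->
  {subset A <= l1} -> forall t, t \in A ++ W -> t \notin l2.
Proof.
move=> us out pe; move: us; rewrite (perm_uniq pe) cat_uniq => /and3P[_ /hasPn d _] sA t.
rewrite mem_cat => /orP[/sA tl|/out]; first by apply: contraL tl => /d.
by rewrite (perm_mem pe) mem_cat negb_or => /andP[].
Qed.

Lemma split_last3 s : 2 < size s -> exists r p a u, s = r ++ [:: p; a; u].
Proof.
case/lastP: s => [|s u] //; case/lastP: s => [|s a] //; case/lastP: s => [|s p] //.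
by exists s, p, a, u; rewrite -!cats1 -!catA.
Qed.

Ltac by_sub := let t := fresh in
  move=> t; rewrite !inE; do ?[case/orP]; move/eqP->; rewrite ?eqxx ?orbT.

(** The bound [L.+1 < m] leaves at least two edges after [y], so the last one, which contains the
    carried vertex, does not begin at [y]. *)
Lemma shortcut_or_carry L v0 l y r u A :
  cyc c true m ((v0 :: l) ++ y :: r) -> outside ((v0 :: l) ++ y :: r) ->
  size (v0 :: l) = 3 * L -> u = v0 \/ u = last y r /\ L.+1 < m -> {subset A <= l} ->
  ~~ joined c true L.+1 u y (A ++ W).
Proof.
move=> cs out szl; have /and3P[/eqP sz us _] := cs.
case=> [->|[-> Lm]] sA.
  apply: (no_shortcut_joint nored cs szl).
  by apply: (avoidW (l1 := v0 :: l) us out) => // t /sA; rewrite inE orbC => ->.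
have [|r' [p [a [w rE]]]] := @split_last3 r.
  by move: sz; rewrite size_cat szl /= => ?; lia.
rewrite {r}rE in cs out us sz *; rewrite last_cat /=.
apply: (no_shortcut_carry nored cs szl).
apply: (avoidW (l1 := l ++ [:: w]) us out) => [|t /sA]; first by by_perm.
by rewrite mem_cat => ->.
Qed.

Lemma window_of_cycle v0 v1 v2 v3 v4 v5 v6 r u :
  let s := [:: v0, v1, v2, v3, v4, v5, v6 & r] in
  cyc c true m s -> outside s -> u = v0 /\ 2 < m \/ u = last v6 r /\ 3 < m ->
  window c u v1 v2 v3 v4 v5 v6 W.
Proof.
move=> s cs out uP; have /and3P[/eqP sz us ps] := cs.
apply/and5P; split.
- have [l2 pe] : exists l2, perm_eq s ([:: u; v1; v2; v3; v4; v5; v6] ++ l2).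
    case: uP => -[-> m2]; first by exists r.
    case/lastP: r @s cs out sz us ps => [|r w] s cs out sz us ps.
      by move: sz => /=; lia.
    exists (v0 :: r); rewrite last_rcons /s -cats1; by_perm.
  move: us; rewrite (perm_uniq pe) !cat_uniq => /andP[-> _] /=.
  rewrite uW andbT; apply/hasPn=> t /out.
  by rewrite (perm_mem pe) mem_cat negb_or => /andP[].
- by move: ps => /= /and3P[_ /eqP].
- apply: (@shortcut_or_carry 1 v0 [:: v1; v2] v3 [:: v4, v5, v6 & r]) => //.
  by case: uP => -[-> ?]; [left | right; split=> //; lia].
- have c3 : cyc c true m (rot (3 * 1) s) by apply: cyc_rot cs.
  rewrite /s /rot /= in c3.
  apply: (no_shortcut_joint nored (l := [:: v4; v5]) (L := 1) (s := r ++ [:: v0; v1; v2])) => //.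
  apply: (avoidW (l1 := [:: v3; v4; v5]) us out); first by rewrite /s; by_perm.
  by by_sub.
apply: (@shortcut_or_carry 2 v0 [:: v1; v2; v3; v4; v5] v6 r) => //.
by case: uP => -[-> ?]; [left | right].
Qed.

End Chain.

(** * Consecutive windows and the vertex handed on *)

Section Blocks.
Variables (T : finType) (c : {set T} -> bool) (m : nat) (W : seq T).
Hypothesis nored : forall l, ~~ cyc c true m.+1 l.
Hypothesis uW : uniq W.
Implicit Types (l s A S B : seq T) (x y u : T).

(** A block pairs the vertices that a window contributes with its exceptional vertices of W. *)
Definition good (b : seq T * seq T) := size b.2 <= 2 /\
  forall x y, x \in W -> y \in W -> x \notin b.2 -> y \notin b.2 -> x != y ->
    joined c false 2 x y b.1.

(* The blue paths avoid [v0], which is thus available at the end of a blue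
   cycle that starts with this window. *)
Definition startable s :=
  if s is v0 :: v1 :: v2 :: v3 :: v4 :: v5 :: v6 :: _ then
    almost_all W (far c v1 v2 v3 v4 v6)
  else False.

(** [perm_eq] stands in for rotation: all that is used later is a red cycle on the same vertices. *)
Definition start s := exists l, [/\ perm_eq l s, cyc c true m l & startable l].

Lemma outside_perm l s : perm_eq l s -> outside W s -> outside W l.
Proof. by move=> pe out t /out; rewrite (perm_mem pe). Qed.

Lemma start_perm l s : perm_eq l s -> start l -> start s.
Proof. by move=> pe [l' [pl cl sl]]; exists l'; split=> //; apply: perm_trans pe. Qed.

(** Near paths leave the joint [v6] to the next window. Far paths use [v6] and leave [v5], the last
    entry once the cycle is rotated by two edges; they also make the window startable. *)
Lemma first_block v0 v1 v2 v3 v4 v5 v6 r u :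
  let s := [:: v0, v1, v2, v3, v4, v5, v6 & r] in
  cyc c true m s -> outside W s -> u = v0 /\ 2 < m \/ u = last v6 r /\ 3 < m ->
  exists S B u1, [/\ good (S, B), uniq (u1 :: S),
    {subset u1 :: S <= [:: u; v1; v2; v3; v4; v5; v6]}
    & u1 = v6 \/ u1 = v5 /\ start s].
Proof.
move=> s cs out uP; have win := window_of_cycle nored uW cs out uP.
have /andP[uw _] := win; move: uw; rewrite cat_uniq => /andP[uw _].
case: (window_dichotomy win) => -[B szB BP].
  exists [:: u; v1; v2; v3; v4; v5], B, v6; split.
  - by split.
  - by rewrite (@perm_uniq _ _ [:: u; v1; v2; v3; v4; v5; v6]) //; by_perm.
  - by move=> t; rewrite !inE => /orP[->|/or4P[-> | -> | -> | /or3P[]->]]; rewrite ?orbT.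
  - by left.
exists [:: v1; v2; v3; v4; v6], B, v5; split.
- by split.
- move: uw; rewrite (@perm_uniq _ _ (u :: [:: v5; v1; v2; v3; v4; v6])).
    by case/andP.
  by by_perm.
- by move=> t; rewrite !inE => /orP[->|/or4P[-> | -> | -> | /orP[]->]]; rewrite ?orbT.
by right; split=> //; exists s; split=> //; exists B.
Qed.

(** The last clause says that a chain beginning at a joint ends with an inner vertex only if some
    window has far paths, hence only if a blue cycle can be started there. *)
Lemma chain k s u : cyc c true m s -> outside W s -> 6 * k < 3 * m -> 2 < m ->
  u = head u s \/ u = last u s /\ (0 < k -> 3 < m) ->
  exists bs u', let s' := rot (6 * k) s in
  [/\ size bs = k, forall b, b \in bs -> good b,
      uniq (u' :: flatten (map fst bs)),
      {subset u' :: flatten (map fst bs) <= u :: take (6 * k) (behead s)}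
    & (u' = head u' s' \/ u' = last u' s') /\
      (u = head u s -> start s \/ u' = head u' s')].
Proof.
elim: k s u => [|k IH] s u cs out km m3 uP.
  exists [::], u; rewrite muln0 rot0 take0; split=> //.
  by split=> [|?]; [case: uP => [?|[? _]]; [left | right] | right].
have /and3P[/eqP sz us _] := cs.
case: s cs out uP sz us => [|v0 [|v1 [|v2 [|v3 [|v4 [|v5 [|v6 r]]]]]]] cs out uP sz us;
  try by move: sz => /=; lia.
have [|S [B [u1 [gS uS subS u1P]]]] := @first_block v0 v1 v2 v3 v4 v5 v6 r u cs out.
  by case: uP => [/= ->|[/= -> m4]]; [left | right; split=> //; apply: m4].
have pe : perm_eq (rot 6 [:: v0, v1, v2, v3, v4, v5, v6 & r]) [:: v0, v1, v2, v3, v4, v5, v6 & r].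
  by rewrite perm_rot.
have [|||||bs [u' [szb gb ub sub [u'P u'S]]]] := IH (rot 6 [:: v0, v1, v2, v3, v4, v5, v6 & r]) u1.
- by apply: (cyc_rot (k := 2)) cs; rewrite sz; lia.
- exact: outside_perm pe out.
- by lia.
- by [].
- rewrite /rot /= ?drop0 ?take0 last_cat /=.
  (* If another window follows, then 12 < 3m, which gives the bound asked for a carried vertex. *)
  by case: u1P => [->|[-> _]]; [left | right; split=> // k0; lia].
have rE : rot (6 * k) (rot 6 [:: v0, v1, v2, v3, v4, v5, v6 & r]) =
    rot (6 * k.+1) [:: v0, v1, v2, v3, v4, v5, v6 & r].
  by rewrite -rotD ?mulnSr // sz; lia.
exists ((S, B) :: bs), u'; rewrite -rE.
have szr : 6 * k <= size r by move: sz km => /=; lia.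
have tE : take (6 * k) (behead (rot 6 [:: v0, v1, v2, v3, v4, v5, v6 & r])) = take (6 * k) r.
  by rewrite /rot /= ?drop0 take_cat; case: ltnP szr => // ? ?;
     rewrite (_ : 6 * k - size r = 0) ?cats0 ?take_oversize //; lia.
rewrite tE in sub.
have szt : take (6 * k.+1) (behead [:: v0, v1, v2, v3, v4, v5, v6 & r]) =
   [:: v1, v2, v3, v4, v5, v6 & take (6 * k) r] by rewrite mulnS.
have uall : uniq ([:: u; v1; v2; v3; v4; v5; v6] ++ take (6 * k) r).
  have us' : uniq ([:: v0, v1, v2, v3, v4, v5, v6 & take (6 * k) r ++ drop (6 * k) r]).
    by rewrite cat_take_drop.
  (* Since 6(k+1) < 3m with both multiples of 3, vertices remain beyond the stretch; a carried [u]
     is the last of them. *)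
  have szd : 0 < size (drop (6 * k) r) by rewrite size_drop; move: sz km => /=; lia.
  case: uP => [/= ->|[/= -> _]].
    have : uniq (([:: v0; v1; v2; v3; v4; v5; v6] ++ take (6 * k) r) ++ drop (6 * k) r).
      by rewrite -catA.
    by rewrite [uniq ((_ ++ _) ++ _)]cat_uniq => /andP[].
  have -> : last v6 r = last v6 (drop (6 * k) r).
    rewrite -{1}(cat_take_drop (6 * k) r) last_cat.
    by case: (drop _ r) szd.
  case/lastP: (drop _ r) szd us' => [|d w] // _; rewrite last_rcons => us'.
  have : uniq (([:: w; v1; v2; v3; v4; v5; v6] ++ take (6 * k) r) ++ v0 :: d).
    by rewrite (@perm_uniq _ _ [:: v0, v1, v2, v3, v4, v5, v6 & take (6 * k) r ++ rcons d w]) //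
      -cats1; by_perm.
  by rewrite [uniq ((_ ++ _) ++ _)]cat_uniq => /andP[].
have dis t : t \in u' :: flatten (map fst bs) -> t \notin S.
  move=> /sub; rewrite inE => /orP[/eqP->|tr].
    by move: uS => /= /andP[].
  apply/negP=> tS; move: uall; rewrite cat_uniq => /and3P[_ /hasPn /(_ t tr) /negP + _].
  by apply; apply: subS; rewrite inE tS orbT.
rewrite szt -[u :: _]/([:: u; v1; v2; v3; v4; v5; v6] ++ take (6 * k) r).
rewrite [map _ _]/= [flatten _]/=; split=> //.
- by rewrite /= szb.
- by move=> b; rewrite inE => /orP[/eqP->|/gb].
- move: uS ub => /= /andP[_ uS] /andP[u'b ub].
  rewrite /= mem_cat negb_or u'b cat_uniq uS ub !andbT (dis u') ?inE ?eqxx //=.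
  by apply/hasPn=> t tb; apply: dis; rewrite inE tb orbT.
- move=> t; rewrite inE mem_cat orbCA => /orP[tS|tb].
    have := subS t; rewrite inE tS orbT => /(_ isT).
    by rewrite mem_cat => ->.
  have := sub t; rewrite inE tb => /(_ isT); rewrite inE mem_cat => /orP[/eqP->|->];
    last by rewrite orbT.
  by rewrite subS ?inE ?eqxx.
split=> // uh.
case: u1P => [u1E|[_ ?]]; last by left.
case: u'S => [|/(start_perm pe)|]; [by rewrite u1E /rot /= ?drop0 | by left | by right].
Qed.

End Blocks.

(** * Closing the blue cycle *)

Section Assembly.
Variable T : finType.
Implicit Types (l s A Q B F : seq T) (x y u : T).

Lemma behead_rot n j s : n + j < size s ->
  take j (behead (rot n s)) = take j (drop n (behead s)).
Proof.
move=> nj; have d n' : behead (drop n' s) = drop n'.+1 s by rewrite -drop1 drop_drop add1n.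
have dn : drop n (behead s) = drop n.+1 s by rewrite -drop1 drop_drop addn1.
have : 0 < size (drop n s) by rewrite size_drop; lia.
rewrite dn -d /rot; case E : (drop n s) => [|a t] //= _.
have : j <= size t by have := size_drop n s; rewrite E /=; lia.
by move=> jt; rewrite take_cat; case: ltngtP jt => // -> _; rewrite subnn take0 cats0 take_size.
Qed.

Lemma chain_next n j s u u' F :
  uniq (u' :: F) -> {subset u' :: F <= u :: take n (behead s)} ->
  n + j < size s -> uniq (u :: take (n + j) (behead s)) ->
  uniq (u' :: F ++ take j (behead (rot n s))) /\
  {subset u' :: F ++ take j (behead (rot n s)) <= u :: take (n + j) (behead s)}.
Proof.
move=> uF sF nj ut; rewrite behead_rot // takeD in ut *.
rewrite -!cat_cons; split; last first.
  by move=> t; rewrite !mem_cat => /orP[/sF->|->]; rewrite ?orbT.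
move: ut; rewrite -cat_cons !cat_uniq uF => /and3P[_ /hasPn d ->]; rewrite andbT /=.
by apply/hasPn=> t /d; apply: contra => /sF.
Qed.

Variable W : seq T.
Hypothesis uW : uniq W.

Lemma pick F : size F < size W -> exists2 x, x \in W & x \notin F.
Proof.
move=> FW; apply/hasP; rewrite -[has _ _]negbK -all_predC; apply/negP=> /allP H.
have /(uniq_leq_size uW) : {subset W <= F} by move=> x /H /=; rewrite negbK.
by rewrite leqNgt FW.
Qed.

Fixpoint placed x (xs : seq T) (Bs : seq (seq T)) : bool :=
  match xs, Bs with
  | [::], [::] => true
  | y :: xs', B :: Bs' => [&& x \notin B, y \notin B & placed y xs' Bs']
  | _, _ => false
  end.

(* A vertex of [W] between two windows has to avoid both sets of bad vertices,
   of size at most 2 each: hence the 4. *)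
Lemma place_tail B Bs F : (forall B', B' \in B :: Bs -> size B' <= 2) ->
  size F + size Bs + 4 <= size W ->
  exists y ys, [/\ y \notin B, placed y ys Bs, uniq (y :: ys),
    {subset y :: ys <= W} & forall t, t \in y :: ys -> t \notin F].
Proof.
elim: Bs B F => [|B' Bs IH] B F szB szF.
  have [|y yW] := @pick (F ++ B).
    by rewrite size_cat; have := szB B; rewrite inE eqxx => /(_ isT); move: szF => /=; lia.
  rewrite mem_cat negb_or => /andP[yF yB]; exists y, [::]; split=> //.
    by move=> t; rewrite inE => /eqP->.
  by move=> t; rewrite inE => /eqP->.
have [|y yW] := @pick (F ++ B ++ B').
  have := szB B; have := szB B'; rewrite !inE !eqxx orbT => /(_ isT) ? /(_ isT) ?.
  by rewrite !size_cat; move: szF => /=; lia.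
rewrite !mem_cat !negb_or => /and3P[yF yB yB'].
have [||z [zs [zB pl uz zW zF]]] := IH B' (y :: F).
- by move=> B'' B''in; apply: szB; rewrite inE B''in orbT.
- by move: szF => /=; lia.
exists y, (z :: zs); split=> //.
- by rewrite /= yB' zB.
- rewrite cons_uniq uz andbT; apply/negP=> /zF; by rewrite inE eqxx.
- by move=> t; rewrite inE => /orP[/eqP->|/zW].
by move=> t; rewrite inE => /orP[/eqP->|/zF] //; rewrite inE negb_or => /andP[].
Qed.

(** The first vertex is chosen last: like the final one it has a single exceptional set to avoid.
    Choosing greedily from it onwards would require one more vertex of W, which is not guaranteed
    for even m. *)
Lemma place B Bs : (forall B', B' \in B :: Bs -> size B' <= 2) ->
  size Bs + 4 <= size W ->
  exists x xs, [/\ placed x xs (B :: Bs), uniq (x :: xs) & {subset x :: xs <= W}].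
Proof.
move=> szB szW; have [|y [ys [yB pl uy yW _]]] := @place_tail B Bs [::] szB.
  by rewrite add0n.
have szy : size ys = size Bs.
  by elim: (ys) (y) (Bs) pl => [|z zs IH] y' [|B'' Bs''] //= /and3P[_ _ /IH->].
have [|x xW] := @pick (B ++ y :: ys).
  by rewrite size_cat /= szy; have := szB B; rewrite inE eqxx => /(_ isT); move: szW => /=; lia.
rewrite mem_cat negb_or => /andP[xB xy]; exists x, (y :: ys); split.
- by rewrite /= xB yB.
- by rewrite cons_uniq xy.
by move=> t; rewrite inE => /orP[/eqP->|/yW].
Qed.

End Assembly.

(** * Stringing the blue paths together *)

Section Linking.
Variables (T : finType) (c : {set T} -> bool) (W : seq T).
Implicit Types (l s A Q B F : seq T) (x y u : T).

Fixpoint linked x (xs : seq T) (Ss : seq (seq T)) : bool :=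
  match xs, Ss with
  | [::], [::] => true
  | y :: xs', Q :: Ss' => joined c false 2 x y Q && linked y xs' Ss'
  | _, _ => false
  end.

Lemma linked_size x xs Ss : linked x xs Ss -> size xs = size Ss.
Proof. by elim: xs x Ss => [|y xs IH] x [|Q Ss] //= /andP[_ /IH->]. Qed.

Lemma linked_rcons x xs y Ss Q :
  linked x (rcons xs y) (rcons Ss Q) = linked x xs Ss && joined c false 2 (last x xs) y Q.
Proof.
elim: xs x Ss => [|z xs IH] x [|Q' Ss] //=; first by rewrite andbT.
- by case: Ss => [|? ?]; rewrite /= ?andbF.
- by case: xs {IH} => [|? ?]; rewrite /= ?andbF.
by rewrite IH andbA.
Qed.

Lemma placed_linked x xs (bs : seq (seq T * seq T)) :
  (forall b, b \in bs -> good c W b) -> uniq (x :: xs) -> {subset x :: xs <= W} ->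
  placed x xs (map snd bs) -> linked x xs (map fst bs).
Proof.
elim: bs x xs => [|[Q B] bs IH] x [|y xs] //= gb /andP[xN uy] xW /and3P[xB yB pl].
apply/andP; split; last first.
  apply: IH => //; first by move=> b bb; apply: gb; rewrite inE bb orbT.
  by move=> t ty; apply: xW; rewrite inE ty orbT.
have [_ /(_ x y)] := gb (Q, B) (mem_head _ _); apply=> //.
- by apply: xW; rewrite inE eqxx.
- by apply: xW; rewrite !inE eqxx orbT.
by apply: contra xN => /eqP->; rewrite inE eqxx.
Qed.

Lemma linked_path x xs Ss : linked x xs Ss -> uniq (x :: xs) ->
  uniq (flatten Ss) -> (forall t, t \in x :: xs -> t \notin flatten Ss) ->
  exists l, [/\ size l = 6 * size Ss, uniq (rcons l (last x xs)),
    lpath c false l (last x xs), head (last x xs) l = x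
    & {subset l <= (x :: xs) ++ flatten Ss}].
Proof.
elim: Ss x xs => [|Q Ss IH] x [|y xs] //=; first by exists [::].
move=> /andP[/joinedP[q [szq uq qS pq]] lk] /andP[xN uy].
rewrite cat_uniq => /and3P[uS /hasPn dS uSs] dW.
have [|l [szl ul pl hl sl]] := IH y xs lk uy uSs.
  move=> t ty; have := dW t; rewrite inE ty orbT => /(_ isT).
  by rewrite mem_cat negb_or => /andP[].
have dq t : t \in q -> (t \notin x :: y :: xs) && (t \notin flatten Ss).
  move=> /qS tS; apply/andP; split; last by apply: contraL tS => /dS.
  by apply: contraL tS => /dW; rewrite mem_cat negb_or => /andP[].
have xSs : x \notin flatten Ss.
  by have := dW x; rewrite inE eqxx mem_cat negb_or => /(_ isT) /andP[].
exists (x :: q ++ l); split=> //.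
- by rewrite /= size_cat szq szl /=; clear; lia.
- have sub t : t \in rcons l (last y xs) -> t \in (y :: xs) ++ flatten Ss.
    rewrite mem_rcons inE => /orP[/eqP->|/sl //].
    by rewrite mem_cat mem_last.
  rewrite rcons_cons rcons_cat cons_uniq cat_uniq ul andbT; apply/and3P; split.
  + rewrite mem_cat negb_or; apply/andP; split.
      by move: uq; rewrite /= inE negb_or => /andP[/andP[]].
    by apply/negP=> /sub; rewrite mem_cat (negbTE xN) (negbTE xSs).
  + by move: uq => /= /and3P[].
  + apply/hasPn=> t /sub; rewrite mem_cat => ts; apply/negP=> /dq.
    by rewrite inE negb_or => /andP[/andP[_ /negbTE ty] /negbTE tSs]; move: ts; rewrite ty tSs.
- have szxq : size (x :: q) = 3 * 2 by rewrite /= szq.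
  by rewrite -cat_cons (lpath_cat _ _ _ _ szxq) hl pq.
move=> t; rewrite inE mem_cat => /or3P[/eqP->|tq|/sl].
- by rewrite inE eqxx.
- by rewrite !inE !mem_cat (qS _ tq) !orbT.
by rewrite !inE !mem_cat => /orP[->|/orP[->|->]]; rewrite ?orbT.
Qed.

Lemma close_cycle x xs Ss j A : 0 < size Ss -> 0 < j -> linked x xs Ss -> uniq (x :: xs) ->
  uniq (flatten Ss) -> (forall t, t \in x :: xs -> t \notin flatten Ss) ->
  joined c false j (last x xs) x A ->
  (forall t, t \in A -> (t \notin x :: xs) && (t \notin flatten Ss)) ->
  exists l, cyc c false (2 * size Ss + j) l.
Proof.
move=> Ss0 j0 lk ux uS dS /joinedP[q [szq uq qA pq]] dA.
have [l [szl ul pl hl sl]] := linked_path lk ux uS dS.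
case: l szl ul pl hl sl => [|x' l]; first by move=> /= ?; exfalso; lia.
move=> szl ul pl /= x'E sl; rewrite {x'}x'E in szl ul pl sl.
exists ((x :: l) ++ last x xs :: q); apply/and3P; split.
- by rewrite size_cat szl /= szq; apply/eqP; lia.
- rewrite -cat_rcons cat_uniq ul /=; apply/andP; split; last first.
    by move: uq => /= /and3P[].
  apply/hasPn=> t /qA /dA /andP[tx tS]; apply/negP=> tr.
  have : t \in rcons (x :: l) (last x xs) by [].
  rewrite mem_rcons inE; case/orP=> [/eqP tE|/sl]; first by move: tx; rewrite tE mem_last.
  move=> ts; have : t \in (x :: xs) ++ flatten Ss by [].
  by rewrite mem_cat (negbTE tx) (negbTE tS).
have szl' : size (x :: l) = 3 * (2 * size Ss) by rewrite szl mulnA.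
suff: lpath c false ((x :: l) ++ last x xs :: q) x by [].
by rewrite (lpath_cat _ _ _ _ szl') /= pl pq.
Qed.

End Linking.

Section ClosingUp.
Variables (T : finType) (c : {set T} -> bool) (W V : seq T).
Hypothesis uW : uniq W.
Hypothesis WV : outside W V.
Implicit Types (l s A Q B F : seq T) (x y z p q r u : T).

(** [V] is the vertex set of the red cycle. The closing path may use the part [A] of [V] left over
    by the blocks and further vertices [A'] of W. *)
Lemma close_blocks n x xs Qs j A A' :
  (forall l, ~~ cyc c false n l) -> 2 * size Qs + j = n -> 0 < size Qs -> 0 < j ->
  linked c x xs Qs -> uniq (x :: xs) -> {subset x :: xs <= W} ->
  uniq (flatten Qs ++ A) -> {subset flatten Qs ++ A <= V} ->
  {subset A' <= W} -> (forall t, t \in A' -> t \notin x :: xs) ->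
  joined c false j (last x xs) x (A ++ A') -> False.
Proof.
move=> noblue nE Q0 j0 lk ux xW uQ QV A'W A'x J; subst n.
have Qx t : t \in x :: xs -> t \notin flatten Qs.
  by move=> /xW /WV; apply: contra => tQ; apply: QV; rewrite mem_cat tQ.
move: uQ; rewrite cat_uniq => /and3P[uQ /hasPn dQ _].
have [|l cl] := close_cycle Q0 j0 lk ux uQ Qx J; last by rewrite (negbTE (noblue _)) in cl.
move=> t; rewrite mem_cat => /orP[tA|tA']; apply/andP; split.
- by apply/negP=> /xW /WV; rewrite QV // mem_cat tA orbT.
- exact: dQ.
- exact: A'x.
by apply: contra (WV (A'W _ tA')) => tQ; apply: QV; rewrite mem_cat tQ.
Qed.

Lemma place_blocks (bs : seq (seq T * seq T)) : 0 < size bs ->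
  (forall b, b \in bs -> good c W b) -> size bs + 3 <= size W ->
  exists x xs, [/\ linked c x xs (map fst bs), uniq (x :: xs) & {subset x :: xs <= W}].
Proof.
move=> b0 gb szW; case E : (map snd bs) => [|B Bs].
  by move: b0; rewrite -(size_map snd bs) E.
have szB : size bs = (size Bs).+1 by rewrite -(size_map snd bs) E.
have [||x [xs [pl ux xW]]] := @place T W uW B Bs.
- by move=> B'; rewrite -E => /mapP[b /gb[? _] ->].
- by rewrite szB in szW; move: szW; clear; lia.
exists x, xs; split=> //; apply: placed_linked gb ux xW _; by rewrite E.
Qed.

(** The chain occupies [size bs + 1] vertices of W and the closing path of two edges may need three
    more, whence [size bs + 4]. *)
Lemma close_odd (bs : seq (seq T * seq T)) A : 0 < size bs ->
  (forall b, b \in bs -> good c W b) -> size bs + 4 <= size W ->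
  (forall l, ~~ cyc c false (2 * size bs + 2) l) ->
  uniq (flatten (map fst bs) ++ A) -> {subset flatten (map fst bs) ++ A <= V} ->
  (forall x z p q r, uniq [:: x; z; p; q; r] -> {subset [:: x; z; p; q; r] <= W} ->
    joined c false 2 x z (A ++ [:: p; q; r])) -> False.
Proof.
move=> b0 gb szW noblue uA AV J.
have [|x [xs [lk ux xW]]] := place_blocks b0 gb; first by move: szW; clear; lia.
have szx := linked_size lk; rewrite size_map in szx.
have [|p pW pN] := @pick T W uW (x :: xs); first by rewrite /= szx; move: szW; clear; lia.
have [|q qW qN] := @pick T W uW (p :: x :: xs); first by rewrite /= szx; move: szW; clear; lia.
have [|r rW rN] := @pick T W uW (q :: p :: x :: xs); first by rewrite /= szx; move: szW; clear;
  lia.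
move: qN; rewrite inE negb_or => /andP[qp qN].
move: rN; rewrite inE negb_or => /andP[rq]; rewrite inE negb_or => /andP[rp rN].
have lx : last x xs \in x :: xs by rewrite mem_last.
have lN : last x xs != x.
  case: xs lk ux {xW szx pN qN rN} lx => [|y xs] lk ux lx.
    by case: (bs) b0 lk.
  by move: ux; rewrite /= => /andP[xN _]; apply: contraNneq xN => <-; apply: mem_last.
apply: (close_blocks (Qs := map fst bs) (j := 2) (A' := [:: p; q;
  r]) noblue _ _ _ lk ux xW uA AV);
  rewrite ?size_map //.
- by move=> t; rewrite !inE => /or3P[]/eqP->.
- by move=> t; rewrite !inE => /or3P[]/eqP->; rewrite -in_cons.
apply: J; last first.
  by move=> t; rewrite !inE => /or4P[/eqP->|/eqP->|/eqP->|/orP[]/eqP->] //; apply: xW;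
    rewrite // inE eqxx.
have neq t : t \notin x :: xs -> (t != x) && (t != last x xs).
  move=> tN; apply/andP; split; last by apply: contraNneq tN => ->.
  by apply: contraNneq tN => ->; rewrite inE eqxx.
have /andP[px pl] := neq _ pN; have /andP[qx ql] := neq _ qN; have /andP[rx rl] := neq _ rN.
rewrite /= !inE !negb_or lN ![_ == p]eq_sym ![_ == q]eq_sym ![_ == r]eq_sym.
by rewrite pl ql rl px qx rx qp rq rp.
Qed.

(** The extra block [(Q, B)] lies in the stretch [A] reserved for closing. All blocks together fall
    one edge short of the cycle, so an edge through the two ends of the chain and two further
    vertices of W is red. The extra block is then dropped, and this red edge yields a closing path
    of three edges. *)
Lemma close_even (bs : seq (seq T * seq T)) Q B A : 0 < size bs ->
  (forall b, b \in rcons bs (Q, B) -> good c W b) -> size bs + 4 <= size W ->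
  (forall l, ~~ cyc c false (2 * size bs + 3) l) ->
  {subset Q <= A} -> uniq Q ->
  uniq (flatten (map fst bs) ++ A) -> {subset flatten (map fst bs) ++ A <= V} ->
  (forall x z y p q, uniq [:: x; z; y; p; q] -> {subset [:: x; z; y; p; q] <= W} ->
    hue c [:: z; y; p; q] -> joined c false 3 x z (A ++ [:: y; p; q])) -> False.
Proof.
move=> b0 gb szW noblue QA uQ uA AV J.
have [||x [xs [lk ux xW]]] := place_blocks _ gb; rewrite ?size_rcons //.
  by move: szW; clear; lia.
have szx := linked_size lk; rewrite size_map size_rcons in szx.
case/lastP: xs szx lk ux xW => [|xs y] // szx lk ux xW.
rewrite size_rcons in szx; case: szx => szx.
move: (lk); rewrite map_rcons linked_rcons => /andP[lk' _].
have [|p pW pN] := @pick T W uW (x :: rcons xs y).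
  by rewrite /= size_rcons szx; move: szW; clear; lia.
have [|q qW qN] := @pick T W uW (p :: x :: rcons xs y).
  by rewrite /= size_rcons szx; move: szW; clear; lia.
move: qN; rewrite inE negb_or => /andP[qp qN].
have pqN t : t \in [:: p; q] -> t \notin x :: rcons xs y by rewrite !inE => /orP[]/eqP->.
have pqW t : t \in [:: p; q] -> t \in W by rewrite !inE => /orP[]/eqP->.
have xy : x != y.
  by move: ux => /= /andP[+ _]; rewrite mem_rcons inE negb_or => /andP[].
have neq t : t \in x :: rcons xs y -> (t != p) && (t != q).
  by move=> tx; apply/andP; split; [apply: contraNneq pN => <-|apply: contraNneq qN => <-].
have yx : y \in x :: rcons xs y by rewrite inE mem_rcons inE eqxx orbT.
have fE : flatten (map fst (rcons bs (Q, B))) = flatten (map fst bs) ++ Q.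
  by rewrite map_rcons -cats1 flatten_cat /= cats0.
have sub1 t : t \in flatten (map fst bs) ++ Q -> t \in flatten (map fst bs) ++ A.
  by rewrite !mem_cat => /orP[->|/QA->]; rewrite ?orbT.
have red : hue c [:: x; y; p; q].
  apply: contraT => blue.
  exfalso; apply: (close_blocks (Qs := map fst (rcons bs (Q, B))) (j := 1) (A := [::])
    (A' := [:: p; q]) noblue _ _ _ lk ux xW); rewrite ?size_map ?size_rcons ?fE ?cats0 //.
  - by clear; lia.
  - move: uA; rewrite !cat_uniq uQ => /and3P[-> /hasPn d _]; rewrite andbT /=.
    by apply/hasPn=> t /QA /d.
  - by move=> t /sub1 /AV.
  rewrite last_rcons; apply/joinedP; exists [:: p; q]; split=> //.
    have [/andP[yp yq] /andP[xp xq]] := (neq _ yx, neq x (mem_head _ _)).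
    by rewrite /= !inE !negb_or eq_sym xy yp yq xp xq eq_sym qp.
  rewrite /= andbT (@hue_eq _ _ _ [:: x; y; p; q]); first by rewrite (negbTE blue).
  by move=> t; rewrite !inE; case: (t == x); case: (t == y); case: (t == p); case: (t == q).
have ux' : uniq (x :: xs) by move: ux; rewrite -rcons_cons rcons_uniq => /andP[].
have yN : y \notin x :: xs by move: ux; rewrite -rcons_cons rcons_uniq => /andP[].
have sx t : t \in x :: xs -> t \in x :: rcons xs y.
  by rewrite !inE mem_rcons inE => /orP[->|->]; rewrite ?orbT.
apply: (close_blocks (Qs := map fst bs) (j := 3) (A' := [:: y; p;
  q]) noblue _ _ _ lk' ux' _ uA AV);
  rewrite ?size_map //.
- by move=> t /sx /xW.
- by move=> t; rewrite inE => /orP[/eqP->|/pqW //]; apply: xW.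
- by move=> t; rewrite inE => /orP[/eqP->|/pqN] //; apply: contra => /sx.
have lN : last x xs != x.
  case: (xs) szx lk' ux' => [|w ws] szx' _ /=; first by move: szx' b0 => /= <-.
  by case/andP=> xN _; apply: contraNneq xN => <-; apply: mem_last.
have lx := mem_last x xs.
apply: J => //; last first.
  move=> t; rewrite !inE => /or4P[/eqP->|/eqP->|/eqP->|/orP[]/eqP->] //.
  - by apply/xW/sx.
  - by apply: xW; rewrite inE eqxx.
  - exact: xW.
have /andP[lp lq] := neq _ (sx _ lx); have /andP[xp xq] := neq x (mem_head _ _).
have /andP[yp yq] := neq _ yx.
have ly : last x xs != y by apply: contraNneq yN => <-.
by rewrite /= !inE !negb_or lN ly lp lq xy xp xq yp yq eq_sym qp.
Qed.

End ClosingUp.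

(** * A missing closing path forces far paths *)

Section Blocked.
Variables (T : finType) (c : {set T} -> bool) (W : seq T).
Hypothesis uW : uniq W.
Implicit Types (x y z p q r a b u : T).

(** The exceptional vertices are [x] and [z]. Other pairs are sorted by how many of their vertices
    lie in {p, q, r}; the first two premises take this triple in any order, so that one certificate
    covers each sort. *)
Lemma almost_all_triple (R : rel T) x z p q r : symmetric R ->
  uniq [:: x; z; p; q; r] ->
  (forall a b d, uniq [:: x; z; a; b; d] -> [:: a; b; d] =i [:: p; q; r] -> R a b) ->
  (forall a b d e, uniq [:: x; z; a; b; d; e] -> [:: a; b; d] =i [:: p; q; r] ->
     e \in W -> R a e) ->
  (forall e f, uniq [:: x; z; p; q; r; e; f] -> e \in W -> f \in W -> R e f) ->
  almost_all W R.
Proof.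
move=> Rsym u R2 R1 R0; exists [:: x; z] => // a b aW bW aN bN ab.
have key t : t \in [:: p; q; r] -> exists b' d,
    uniq [:: x; z; t; b'; d] /\ [:: t; b'; d] =i [:: p; q; r].
  rewrite !inE => /or3P[] /eqP->.
  - by exists q, r.
  - exists p, r; split.
      by rewrite (@perm_uniq _ _ [:: x; z; p; q; r]) //; apply/permP=> ?; rewrite /=; clear; lia.
    by move=> s; rewrite !inE orbCA.
  exists p, q; split.
    by rewrite (@perm_uniq _ _ [:: x; z; p; q; r]) //; apply/permP=> ?; rewrite /=; clear; lia.
  by move=> s; rewrite !inE; case: (s == p); case: (s == q); case: (s == r).
have ext t b' d e : uniq [:: x; z; t; b'; d] -> [:: t; b'; d] =i [:: p; q; r] ->
    e \notin [:: x; z] -> e \notin [:: p; q; r] -> uniq [:: x; z; t; b'; d; e].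
  move=> u' E eN; rewrite -E => eN'.
  rewrite -[[:: x; z; t; b'; d; e]]/(rcons [:: x; z; t; b'; d] e) rcons_uniq u' andbT.
  by rewrite -[[:: x; z; t; b'; d]]/([:: x; z] ++ [:: t; b'; d]) mem_cat negb_or eN.
have one s t : s \in [:: p; q; r] -> t \in W -> t \notin [:: x; z] -> s != t -> R s t.
  move=> /key[b' [d [u' E]]] tW tN st.
  have [tQ|tQ] := boolP (t \in [:: p; q; r]); last exact: (R1 s b' d t (ext _ _ _ _ u' E tN tQ)).
  move: tQ; rewrite -E !inE eq_sym (negbTE st) /= => /orP[]/eqP->; first exact: R2 u' E.
  apply: (R2 s d b').
    by rewrite (@perm_uniq _ _ [:: x; z; s; b'; d]) //; apply/permP=> ?; rewrite /=; clear; lia.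
  by move=> v; rewrite -E !inE; case: (v == s); case: (v == b'); case: (v == d).
have [aQ|aQ] := boolP (a \in [:: p; q; r]); first exact: one.
have [bQ|bQ] := boolP (b \in [:: p; q; r]).
  by rewrite Rsym; apply: one; rewrite // eq_sym.
apply: R0 => //.
have notin t : t \notin [:: x; z] -> t \notin [:: p; q; r] -> t \notin [:: x; z; p; q; r].
  by move=> t1 t2; rewrite -[[:: x; z; p; q; r]]/([:: x; z] ++ [:: p; q; r]) mem_cat negb_or t1.
have -> : [:: x; z; p; q; r; a; b] = rcons (rcons [:: x; z; p; q; r] a) b by [].
rewrite !rcons_uniq u (notin a) // mem_rcons in_cons negb_or eq_sym ab.
by rewrite (notin b).
Qed.

Lemma far_sym s1 s2 s3 s4 s6 : symmetric (far c s1 s2 s3 s4 s6).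
Proof. by move=> x y; rewrite /far joinedC. Qed.

Lemma blocked_edge u s1 s2 s3 s4 s5 s6 x z p q r :
  window c u s1 s2 s3 s4 s5 s6 W -> hue c [:: u; s1; s2; s3] ->
  uniq [:: x; z; p; q; r] -> {subset [:: x; z; p; q; r] <= W} ->
  ~~ joined c false 2 x z [:: u; s1; s2; p; q; r] ->
  almost_all W (far c s1 s2 s3 s4 s6).
Proof.
move=> win h ux xW nj.
have nj' a b d : [:: a; b; d] =i [:: p; q; r] ->
    ~~ joined c false 2 x z [:: u; s1; s2; a; b; d].
  move=> E; apply: contra nj; apply: joined_sub => t.
  by rewrite -[[:: u; s1; s2; a; b; d]]/([:: u; s1; s2] ++ [:: a; b; d]) mem_cat E -mem_cat.
have sub a b d : [:: a; b; d] =i [:: p; q; r] -> {subset [:: x; z; a; b; d] <= W}.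
  move=> E t; rewrite -[[:: x; z; a; b; d]]/([:: x; z] ++ [:: a; b; d]) mem_cat E -mem_cat.
  exact: xW.
apply: (almost_all_triple (far_sym _ _ _ _ _) ux).
- move=> a b d u' E; have sW := sub a b d E.
  exact: (far_T1L_23 (window_sub u' sW win) h (nj' _ _ _ E)).
- move=> a b d e u' E eW.
  have sW : {subset [:: x; z; a; b; d; e] <= W}.
    move=> t; rewrite -[[:: x; z; a; b; d; e]]/([:: x; z; a; b; d] ++ [:: e]) mem_cat mem_seq1.
    by case/orP=> [/(sub a b d E)|/eqP->].
  exact: (far_T1L_25 (window_sub u' sW win) h (nj' _ _ _ E)).
move=> e f u' eW fW.
have sW : {subset [:: x; z; p; q; r; e; f] <= W}.
  move=> t; rewrite -[[:: x; z; p; q; r; e; f]]/([:: x; z; p; q; r] ++ [:: e;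
    f]) mem_cat [_ \in [:: e; f]]in_cons mem_seq1.
  by case/orP=> [/xW|/orP[]/eqP->].
exact: (far_T1L_56 (window_sub u' sW win) h nj).
Qed.

Lemma blocked_window v0 v1 v2 v3 v4 v5 v6 v7 v8 v9 x z y p q :
  uniq ([:: v0; v1; v2; v3; v4; v5; v6; v7; v8; v9] ++ W) ->
  hue c [:: v0; v1; v2; v3] ->
  window c v0 v1 v2 v3 v4 v5 v6 W -> window c v3 v4 v5 v6 v7 v8 v9 W ->
  ~~ joined c true 4 v0 v9 ([:: v1; v2; v3; v4; v5; v6; v7; v8] ++ W) ->
  uniq [:: x; z; y; p; q] -> {subset [:: x; z; y; p; q] <= W} ->
  hue c [:: z; y; p; q] ->
  ~~ joined c false 3 x z [:: v0; v1; v2; v3; v4; v5; y; p; q] ->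
  almost_all W (far c v4 v5 v6 v7 v9).
Proof.
move=> uv h win win' n4 ux xW hW nj.
have nj' a b d : [:: a; b; d] =i [:: y; p; q] ->
    ~~ joined c false 3 x z [:: v0; v1; v2; v3; v4; v5; a; b; d].
  move=> E; apply: contra nj; apply: joined_sub => t.
  rewrite -[[:: v0; v1; v2; v3; v4; v5; a; b; d]]/([:: v0; v1; v2; v3; v4; v5] ++ [:: a; b; d]).
  by rewrite mem_cat E -mem_cat.
have hW' a b d : [:: a; b; d] =i [:: y; p; q] -> hue c [:: z; a; b; d].
  by move=> E; rewrite (@hue_eq _ _ _ [:: z; y; p; q]) // => t; rewrite in_cons [RHS]in_cons E.
have sub a b d : [:: a; b; d] =i [:: y; p; q] -> {subset [:: x; z; a; b; d] <= W}.
  move=> E t; rewrite -[[:: x; z; a; b; d]]/([:: x; z] ++ [:: a; b; d]) mem_cat E -mem_cat.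
  exact: xW.
have uvs ws : uniq ws -> {subset ws <= W} ->
    uniq ([:: v0; v1; v2; v3; v4; v5; v6; v7; v8; v9] ++ ws).
  move=> uws sW; move: uv; rewrite !cat_uniq uws andbT => /and3P[-> /hasPn dW _] /=.
  by apply/hasPn=> t /sW /dW.
have n4s ws : {subset ws <= W} ->
    ~~ joined c true 4 v0 v9 ([:: v1; v2; v3; v4; v5; v6; v7; v8] ++ ws).
  move=> sW; apply: contra n4; apply: joined_sub => t.
  by rewrite !mem_cat => /orP[->|/sW->]; rewrite ?orbT.
apply: (almost_all_triple (far_sym _ _ _ _ _) ux).
- move=> a b d u' E; have sW := sub a b d E.
  exact: (far_TL_23 (uvs _ u' sW) h (window_sub u' sW win) (window_sub u' sW win')
    (n4s _ sW) (hW' _ _ _ E) (nj' _ _ _ E)).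
- move=> a b d e u' E eW.
  have sW : {subset [:: x; z; a; b; d; e] <= W}.
    move=> t; rewrite -[[:: x; z; a; b; d; e]]/([:: x; z; a; b; d] ++ [:: e]) mem_cat mem_seq1.
    by case/orP=> [/(sub a b d E)|/eqP->].
  exact: (far_TL_25 (uvs _ u' sW) h (window_sub u' sW win) (window_sub u' sW win')
    (n4s _ sW) (hW' _ _ _ E) (nj' _ _ _ E)).
move=> e f u' eW fW.
have sW : {subset [:: x; z; y; p; q; e; f] <= W}.
  move=> t; rewrite -[[:: x; z; y; p; q; e; f]]/([:: x; z; y; p; q] ++ [:: e;
    f]) mem_cat [_ \in [:: e; f]]in_cons mem_seq1.
  by case/orP=> [/xW|/orP[]/eqP->].
exact: (far_TL_56 (uvs _ u' sW) h (window_sub u' sW win) (window_sub u' sW win') (n4s _ sW) hW nj).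
Qed.

End Blocked.

(** * Starting at a window with far paths *)

Section StartingWindow.
Variables (T : finType) (c : {set T} -> bool) (m : nat) (W : seq T).
Hypothesis nored : forall l, ~~ cyc c true m.+1 l.
Hypothesis noblue : forall l, ~~ cyc c false m.+1 l.
Hypothesis m3 : 2 < m.
Hypothesis uW : uniq W.
Hypothesis szW : m./2 + 3 + odd m <= size W.
Implicit Types (l s A Q B F r : seq T) (x y z p q u : T).

Lemma cycle_edge v0 v1 v2 v3 r : cyc c true m [:: v0, v1, v2, v3 & r] ->
  hue c [:: v0; v1; v2; v3].
Proof. by case/and3P=> _ _ /= /andP[/eqP]. Qed.

Lemma seq7 s : cyc c true m s -> exists v0 v1 v2 v3 v4 v5 v6 r,
  s = [:: v0, v1, v2, v3, v4, v5, v6 & r].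
Proof.
move=> /and3P[/eqP sz _ _]; move: sz m3; clear.
case: s => [|v0 [|v1 [|v2 [|v3 [|v4 [|v5 [|v6 r]]]]]]] /= sz m3; try by exfalso; lia.
by exists v0, v1, v2, v3, v4, v5, v6, r.
Qed.

Lemma one_edge_cycle v0 v1 v2 v3 r u x z p q :
  cyc c true m [:: v0, v1, v2, v3 & r] -> outside W [:: v0, v1, v2, v3 & r] ->
  uniq [:: u; v1; v2; v3] -> u \in [:: v0, v1, v2, v3 & r] ->
  u = v0 \/ u = last v3 r ->
  uniq [:: x; z; p; q] -> {subset [:: x; z; p; q] <= W} ->
  joined c false 2 x z [:: u; v1; v2; v3; p; q].
Proof.
move=> cs out uu us uP ux xW; apply: one_edge.
  have sub : {subset [:: u; v1; v2; v3] <= [:: v0, v1, v2, v3 & r]}.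
    move=> t; rewrite in_cons => /orP[/eqP-> //|].
    by rewrite !in_cons in_nil orbF => /or3P[->|->|->]; rewrite ?orbT.
  rewrite cat_uniq uu ux andbT; apply/hasPn=> t /xW /out.
  by apply: contra => tu; apply: sub.
have := @shortcut_or_carry T c m W nored uW 1 v0 [:: v1; v2] v3 r u [:: v1; v2] cs out (erefl _).
move=> /(_ _ (fun t h => h)) n2; have : ~~ joined c true 2 u v3 ([:: v1; v2] ++ W).
  by apply: n2; case: uP => ->; [left | right].
apply: contra; apply: joined_sub => t.
by rewrite -[[:: v1; v2; x; z; p; q]]/([:: v1; v2] ++ [:: x; z; p;
  q]) !mem_cat => /orP[->|/xW->]; rewrite ?orbT.
Qed.

(** Far paths in the first window spare [v0] and [v5]: [v5] is carried into the chain, and [v0] is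
    still free when the chain has gone round. The last edge or window is thus entirely available, up
    to the vertex handed on, to [one_edge] or [three_paths]. *)
Lemma start_absurd s : outside W s -> start c m W s -> False.
Proof.
move=> out0 [l [pe cl st]]; have out := outside_perm pe out0.
have [v0 [v1 [v2 [v3 [v4 [v5 [v6 [r lE]]]]]]]] := seq7 cl.
rewrite {l}lE in pe cl st out *; set l := [:: v0, v1, v2, v3, v4, v5, v6 & r] in pe cl st out *.
case: st => B szB BP.
have gB : good c W ([:: v1; v2; v3; v4; v6], B) by split.
have /and3P[/eqP szl ul _] := cl.
pose t := rot (3 * 2) l.
have ct : cyc c true m t by apply: cyc_rot cl; rewrite szl; move: m3; clear; lia.
have tE : t = v6 :: r ++ [:: v0; v1; v2; v3; v4; v5] by rewrite /t /rot /= ?drop0.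
have pt : perm_eq t l by rewrite perm_rot.
have outt := outside_perm pt out.
have szr : size r + 7 = 3 * m by rewrite -szl /l /= -addnC.
have lt : last v5 t = v5 by rewrite tE /= last_cat.
(* With the first window this makes [m./2] blocks for odd m and [m./2.-1] for even m. After the last
   joint there remain three or six vertices, the last being [v0]. *)
pose k := if odd m then m./2.-1 else m./2.-2.
pose j := if odd m then 3 else 6.
have kj : 6 * k + j = size r + 1.
  move: szr m3; rewrite /k /j; have := odd_double_half m; clear.
  by case: (odd m) => /=; lia.
have [|||bs [u' [szb gb ub sub [u'P _]]]] := @chain T c m W nored uW k t v5 ct outt.
- by move: kj szr m3; rewrite /j; clear; case: (odd m); lia.
- exact: m3.
- right; split; first by rewrite lt.
  by move: m3; rewrite /k; clear; case: (odd m); lia.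
have tk : take (6 * k + j) (behead t) = rcons r v0.
  by rewrite kj tE /= addn1 -cat_rcons take_size_cat // size_rcons.
have uS0 : uniq ([:: v1; v2; v3; v4; v6] ++ v5 :: rcons r v0).
  rewrite (perm_uniq (s2 := l)) // -cats1; apply/permP=> ?.
  by rewrite /l /= ?count_cat /= ?count_cat /=; clear; lia.
have [||uA sA] := @chain_next T (6 * k) j t v5 u' (flatten (map fst bs)) ub sub.
- by rewrite kj tE /= size_cat /=; clear; lia.
- by rewrite tk; move: uS0; rewrite cat_uniq => /and3P[].
rewrite tk in sA.
pose s' := rot (6 * k) t.
have cs' : cyc c true m s'.
  rewrite /s' -[6 * k]/(3 * 2 * k) -mulnA; apply: cyc_rot ct.
  by rewrite tE /= size_cat /=; move: kj; rewrite /j; clear; case: (odd m); lia.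
have ps' : perm_eq s' t by rewrite perm_rot.
have outs' := outside_perm ps' outt.
have [w0 [w1 [w2 [w3 [w4 [w5 [w6 [r' sE]]]]]]]] := seq7 cs'.
rewrite -/s' sE in uA sA u'P; rewrite sE in cs' outs' ps'.
pose bs' := ([:: v1; v2; v3; v4; v6], B) :: bs.
have gb' b : b \in bs' -> good c W b by rewrite inE => /orP[/eqP->|/gb].
have fE : flatten (map fst bs') = [:: v1; v2; v3; v4; v6] ++ flatten (map fst bs) by [].
have sl t' : t' \in [:: v1; v2; v3; v4; v6] ++ v5 :: rcons r v0 -> t' \in l.
  rewrite (perm_mem (s2 := l)) // -cats1; apply/permP=> ?.
  by rewrite /l /= ?count_cat /= ?count_cat /=; clear; lia.
have comb A : uniq (flatten (map fst bs) ++ A) ->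
  {subset flatten (map fst bs) ++ A <= v5 :: rcons r v0} ->
    uniq (flatten (map fst bs') ++ A) /\ {subset flatten (map fst bs') ++ A <= l}.
  move=> uFA sFA; rewrite fE -catA; split; last first.
    by move=> t'; rewrite mem_cat => /orP[tS|/sFA tr]; apply: sl; rewrite mem_cat ?tS ?tr ?orbT.
  rewrite cat_uniq uFA andbT; move: uS0; rewrite cat_uniq => /and3P[-> /hasPn d _] /=.
  by apply/hasPn=> t' /sFA /d.
have mv X : uniq (u' :: flatten (map fst bs) ++ X) ->
  {subset u' :: flatten (map fst bs) ++ X <= v5 :: rcons r v0} ->
    uniq (flatten (map fst bs) ++ u' :: X) /\ {subset flatten (map fst bs) ++ u' :: X <= v5 :: rcons r v0}.
  move=> uX sX;
    have pX : perm_eq (flatten (map fst bs) ++ u' :: X) (u' :: flatten (map fst bs) ++ X).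
    by rewrite -cat1s perm_catCA.
  split; first by rewrite (perm_uniq pX).
  by move=> t'; rewrite (perm_mem pX); apply: sX.
have /= u'C : u' = w0 \/ u' = last w6 r'.
  by case: u'P => [/= E|/= E]; [left | right]; rewrite {1}E.
have [om|em] := boolP (odd m); last first.
  have jE : j = 6 by rewrite /j (negbTE em).
  have m4 : 3 < m by move: m3 em; clear; case: m => [|[|[|[|?]]]].
  rewrite jE /= in uA sA; rewrite take0 in uA sA.
  have [uA1 sA1] := mv _ uA sA; have [uA2 sA2] := comb _ uA1 sA1.
  have win : window c u' w1 w2 w3 w4 w5 w6 W.
    by apply: (window_of_cycle nored uW cs' outs'); case: u'C; [left | right].
  have uQ : uniq [:: u'; w1; w2; w3; w4; w5; w6].
    by move: uA1; rewrite cat_uniq => /and3P[].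
  (* No window follows this one, so both kinds of paths serve equally well. *)
  have [Q [Bq [gQ QA uq]]] : exists Q Bq, [/\ good c W (Q, Bq),
      {subset Q <= [:: u'; w1; w2; w3; w4; w5; w6]} & uniq Q].
    case: (window_dichotomy win) => -[Bq szq BqP].
      exists [:: u'; w1; w2; w3; w4; w5], Bq; split=> //.
        by move=> t'; rewrite !inE => /or4P[->|->|->|/or3P[]->]; rewrite ?orbT.
      by move: uQ; rewrite -[[:: u'; w1; w2; w3; w4; w5; w6]]/(rcons [:: u'; w1; w2; w3; w4;
        w5] w6) rcons_uniq => /andP[].
    exists [:: w1; w2; w3; w4; w6], Bq; split=> //.
      by move=> t'; rewrite !inE => /or4P[->|->|->|/orP[]->]; rewrite ?orbT.
    move: uQ; rewrite (perm_uniq (s2 := [:: u'; w5] ++ [:: w1; w2; w3; w4; w6])).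
      by rewrite cat_uniq => /and3P[].
    by apply/permP=> ?; rewrite /=; clear; lia.
  have kE : size bs' = m./2.-1.
    by rewrite /= szb /k (negbTE em); move: m4 em; clear => ? ?; have := odd_double_half m; lia.
  apply: (close_even (c := c) uW out _ _ _ _ QA uq uA2 sA2 (bs := bs') (B := Bq)).
  - by [].
  - by move=> b; rewrite mem_rcons in_cons => /orP[/eqP->|/gb'].
  - by rewrite kE; move: szW m4; clear; lia.
  - move=> l'; have -> : 2 * size bs' + 3 = m.+1; last exact: noblue.
    by rewrite kE; move: m4 em; clear => ? em; have := odd_double_half m; rewrite (negbTE em);
      lia.
  move=> x z y p q ux xW hW; have := three_paths (window_sub ux xW win) hW.
  by rewrite -[X in joined c false 3 x z X]/([:: u'; w1; w2; w3; w4; w5; w6] ++ [:: y; p; q]).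
have jE : j = 3 by rewrite /j om.
rewrite jE /= in uA sA.
have [uA1 sA1] := mv _ uA sA; have [uA2 sA2] := comb _ uA1 sA1.
have kE : size bs' = m./2.
  by rewrite /= szb /k om; move: m3; clear; lia.
apply: (close_odd (c := c) uW out _ gb' _ _ uA2 sA2).
- by [].
- by rewrite kE; move: szW; rewrite om; clear; lia.
- move=> l'; have -> : 2 * size bs' + 2 = m.+1; last exact: noblue.
  by rewrite kE; have := odd_double_half m; rewrite om; clear; lia.
move=> x z p q p' ux xW.
have ux4 : uniq [:: x; z; p; q].
  by move: ux; rewrite -[[:: x; z; p; q; p']]/(rcons [:: x; z; p; q] p') rcons_uniq => /andP[].
have xW4 : {subset [:: x; z; p; q] <= W}.
  by move=> t' t'x; apply: xW; rewrite -[[:: x; z; p; q; p']]/([:: x; z; p;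
    q] ++ [:: p']) mem_cat t'x.
have := @one_edge_cycle w0 w1 w2 w3 [:: w4, w5, w6 & r'] u' x z p q cs' outs'.
move=> H; apply: joined_sub (H _ _ _ ux4 xW4).
- by move=> t'; rewrite /= !inE => /or4P[->|->|->|/or3P[]->]; rewrite ?orbT.
- by move: uA1; rewrite cat_uniq => /and3P[].
- case: u'C => ->; first exact: mem_head.
  by have := mem_last w6 r'; rewrite !in_cons => ->; rewrite !orbT.
- exact: u'C.
Qed.

End StartingWindow.

Section InductionStep.
Variables (T : finType) (c : {set T} -> bool) (m : nat) (W : seq T).
Hypothesis nored : forall l, ~~ cyc c true m.+1 l.
Hypothesis noblue : forall l, ~~ cyc c false m.+1 l.
Hypothesis m3 : 2 < m.
Hypothesis uW : uniq W.
Hypothesis szW : m./2 + 3 + odd m <= size W.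
Implicit Types (l s A Q B F r : seq T) (x y z p q u : T).

(** Since [start_absurd] rules out startable windows, every block is near and the chain ends at a
    joint. The closing stretch stops before the first vertex of the cycle, which the first block may
    use; without a closing path there, [blocked_edge] or [blocked_window] would produce a startable
    window. *)
Lemma step_absurd s : cyc c true m s -> outside W s -> False.
Proof.
move=> cs out; have noStart : start c m W s -> False.
  exact: (start_absurd nored noblue m3 uW szW out).
have /and3P[/eqP szs us _] := cs.
have [v0 [a1 [a2 [a3 [a4 [a5 [a6 [a sE]]]]]]]] := seq7 m3 cs.
(* The closing stretch is a joint and [j] further vertices: three in all for odd m, six for even m.
   With the blocks it exhausts the cycle. *)
pose k := if odd m then m./2 else m./2.-1.
pose j := if odd m then 2 else 5.
have kj : 6 * k + j + 1 = size s.
  rewrite szs /k /j; move: m3; have := odd_double_half m; clear.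
  by case: (odd m) => /=; lia.
pose u := head v0 s.
have us' : uniq (u :: take (6 * k + j) (behead s)).
  rewrite take_oversize; last by rewrite size_behead; move: kj; clear; lia.
  by rewrite /u; move: us; rewrite sE.
have [|||bs [u' [szb gb ub sub [_ u'P]]]] := @chain T c m W nored uW k s u cs out.
- by move: kj; rewrite szs /j; clear; case: (odd m); lia.
- exact: m3.
- by left; rewrite /u sE.
have {u'P} u'E : u' = head u' (rot (6 * k) s).
  have uh : u = head u s by rewrite /u sE.
  by case: (u'P uh) => [/noStart|].
have [|| uA sA] := @chain_next T (6 * k) j s u u' (flatten (map fst bs)) ub sub.
- by move: kj; clear; lia.
- exact: us'.
have {}sA : {subset u' :: flatten (map fst bs) ++ take j (behead (rot (6 * k) s)) <= s}.
  move=> t /sA; rewrite inE => /orP[/eqP->|/mem_take]; first by rewrite /u sE mem_head.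
  exact: mem_behead.
pose s' := rot (6 * k) s.
have cs' : cyc c true m s'.
  rewrite /s' -[6 * k]/(3 * 2 * k) -mulnA; apply: cyc_rot cs.
  by move: kj; rewrite /j; clear; case: (odd m); lia.
have ps' : perm_eq s' s by rewrite perm_rot.
have outs' := outside_perm ps' out.
have noStart' : start c m W s' -> False by move/(start_perm ps').
have [w0 [w1 [w2 [w3 [w4 [w5 [w6 [r sE']]]]]]]] := seq7 m3 cs'.
rewrite -/s' sE' /= in uA sA u'E; rewrite {}u'E {u' ub sub} in uA sA.
rewrite sE' in cs' outs' noStart'.
have win : window c w0 w1 w2 w3 w4 w5 w6 W.
  by apply: (window_of_cycle nored uW cs' outs'); left.
have mv X : uniq (w0 :: flatten (map fst bs) ++ X) ->
  {subset w0 :: flatten (map fst bs) ++ X <= s} ->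
    uniq (flatten (map fst bs) ++ w0 :: X) /\ {subset flatten (map fst bs) ++ w0 :: X <= s}.
  move=> uX sX;
    have pX : perm_eq (flatten (map fst bs) ++ w0 :: X) (w0 :: flatten (map fst bs) ++ X).
    by rewrite -cat1s perm_catCA.
  split; first by rewrite (perm_uniq pX).
  by move=> t'; rewrite (perm_mem pX); apply: sX.
have [om|em] := boolP (odd m).
  have jE : j = 2 by rewrite /j om.
  rewrite jE /= ?take0 in uA sA; have [uA1 sA1] := mv _ uA sA.
  have kE : size bs = m./2 by rewrite szb /k om.
  apply: (close_odd (c := c) uW out _ gb _ _ uA1 sA1).
  - by rewrite kE; move: m3; clear; lia.
  - by rewrite kE; move: szW; rewrite om; clear; lia.
  - move=> l'; have -> : 2 * size bs + 2 = m.+1; last exact: noblue.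
    by rewrite kE; have := odd_double_half m; rewrite om; clear; lia.
  move=> x z p q p' ux xW; apply: contraT => nj; exfalso; apply: noStart'.
  exists [:: w0, w1, w2, w3, w4, w5, w6 & r]; split=> //.
  exact: (blocked_edge win (cycle_edge cs') ux xW nj).
have jE : j = 5 by rewrite /j (negbTE em).
rewrite jE /= ?take0 in uA sA; have [uA1 sA1] := mv _ uA sA.
have m4 : 3 < m by move: m3 em; clear; case: m => [|[|[|[|?]]]].
have kE : size bs = m./2.-1 by rewrite szb /k (negbTE em).
have [B gB] : exists B, good c W ([:: w0; w1; w2; w3; w4; w5], B).
  case: (window_dichotomy win) => -[B szB BP]; first by exists B.
  exfalso; apply: noStart'; exists [:: w0, w1, w2, w3, w4, w5, w6 & r]; split=> //.
  by exists B.
have gbs b : b \in rcons bs ([:: w0; w1; w2; w3; w4; w5], B) -> good c W b.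
  by rewrite mem_rcons in_cons => /orP[/eqP->|/gb].
have uQ : uniq [:: w0; w1; w2; w3; w4; w5].
  by move: uA1; rewrite cat_uniq => /and3P[].
apply: (close_even (c := c) uW out _ gbs _ _ (fun t h => h) uQ uA1 sA1).
- by rewrite kE; move: m4; clear; lia.
- by rewrite kE; move: szW m4; clear; lia.
- move=> l'; have -> : 2 * size bs + 3 = m.+1; last exact: noblue.
  by rewrite kE; move: m4 em; clear => ? em; have := odd_double_half m; rewrite (negbTE em); lia.
(* The far paths are forced in the window beginning at [w3], whence the rotation by one edge below;
   its ten vertices are distinct because m > 3. *)
move=> x z y p q ux xW hW; apply: contraT => nj; exfalso; apply: noStart'.
have /and3P[/eqP szs' us1 _] := cs'.
case: r {sE' ps'} cs' outs' szs' us1 => [|w7 [|w8 [|w9 r]]] cs' outs' szs' us1;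
  try by move: szs' m4 => /=; clear; lia.
have cs3 : cyc c true m (rot (3 * 1) [:: w0, w1, w2, w3, w4, w5, w6, w7, w8, w9 & r]).
  by apply: cyc_rot cs'; rewrite szs'; move: m3; clear; lia.
have ps3 : perm_eq (rot (3 * 1) [:: w0, w1, w2, w3, w4, w5, w6, w7, w8, w9 & r])
    [:: w0, w1, w2, w3, w4, w5, w6, w7, w8, w9 & r] by rewrite perm_rot.
have outs3 := outside_perm ps3 outs'.
rewrite /rot /= ?drop0 in cs3 ps3 outs3.
exists [:: w3, w4, w5, w6, w7, w8, w9 & r ++ [:: w0; w1; w2]]; split=> //=.
apply: (blocked_window (v8 := w8) _ (cycle_edge cs') win _ _ ux xW hW nj).
- pose v := [:: w0; w1; w2; w3; w4; w5; w6; w7; w8; w9].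
  have uv : uniq (v ++ r) := us1; have ov : outside W (v ++ r) := outs'.
  rewrite -/v cat_uniq uW andbT; apply/andP; split.
    by move: uv; rewrite cat_uniq => /andP[].
  by apply/hasPn=> t /ov; rewrite mem_cat negb_or => /andP[].
- by apply: (window_of_cycle nored uW cs3 outs3); left.
apply: (shortcut_or_carry (L := 3) (v0 := w0) (l := [:: w1; w2; w3; w4; w5; w6; w7;
  w8]) (r := r) nored uW) => //.
by left.
Qed.

End InductionStep.

(** * Base case and induction *)

Section Complement.
Variables (T : finType) (c : {set T} -> bool).

Definition opposite (X : {set T}) := ~~ c X.

Lemma lpath_opposite b l y : lpath opposite b l y = lpath c (~~ b) l y.
Proof.
have [n] := ubnP (size l); elim: n l => // n IH [|x [|p [|q l]]] //= szl.
rewrite IH; last by move: szl; clear; lia.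
by congr (_ && _); rewrite /hue /opposite; case: (c _); case: (b).
Qed.

Lemma cyc_opposite b n l : cyc opposite b n l = cyc c (~~ b) n l.
Proof. by rewrite /cyc /closed; case: l => [|x l] //; rewrite lpath_opposite. Qed.

Lemma joined_opposite b k x y A : joined opposite b k x y A = joined c (~~ b) k x y A.
Proof. by apply: eq_existsb => q; rewrite lpath_opposite. Qed.

End Complement.

Section Base.
Variable T : finType.
Implicit Types (c : {set T} -> bool) (l s : seq T).

Lemma outside_seq s : {W | [/\ uniq W, outside W s & size W >= #|T| - size s]}.
Proof.
exists [seq x <- enum T | x \notin s]; split.
- by rewrite filter_uniq ?enum_uniq.
- by move=> x; rewrite mem_filter => /andP[].
rewrite size_filter leq_subLR cardE -(count_predC (mem s)) leq_add2r.
rewrite -size_filter; apply: uniq_leq_size; first by rewrite filter_uniq ?enum_uniq.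
by move=> x; rewrite mem_filter => /andP[].
Qed.

(** The two edges are a red cycle of two edges, so [one_edge] joins any two vertices of W by two
    blue edges. A blue edge inside W would complete a blue cycle, so W is entirely red. An edge with
    three vertices in W and one among the given six is then blue, since a red one would lie on a red
    cycle with eight vertices of W. Three such blue edges form a blue cycle. The count 8 + 6 = 14
    gives the bound. *)
Lemma two_edges c (a p q b r s : T) :
  uniq [:: a; p; q; b; r; s] -> hue c [:: a; p; q; b] -> hue c [:: b; r; s; a] ->
  13 < #|T| -> (forall l, ~~ cyc c true 3 l) -> (forall l, ~~ cyc c false 3 l) -> False.
Proof.
move=> u6 h1 h2 cT nored noblue.
have [W [uW out szW]] := outside_seq [:: a; p; q; b; r; s].
have {}szW : 7 < size W by move: szW cT => /=; clear; lia.
have n2 : ~~ joined c true 2 a b ([:: p; q] ++ W).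
  apply: (@no_shortcut T c 2 nored 1 a [:: p; q] b [:: r; s]) => //.
    by rewrite /= andbT; apply/eqP.
  apply: (avoidW (s := [:: a; p; q; b; r; s]) (l1 := [:: a; p; q]) u6 out) => // t.
  by rewrite !inE => /orP[]->; rewrite ?orbT.
have blue x z p' q' : uniq [:: x; z; p'; q'] -> {subset [:: x; z; p'; q'] <= W} ->
    joined c false 2 x z [:: a; p; q; b; p'; q'].
  move=> ux xW; apply: one_edge.
    rewrite cat_uniq ux andbT; apply/andP; split.
      by move: u6; rewrite -[[:: a; p; q; b; r; s]]/([:: a; p; q; b] ++ [:: r;
        s]) cat_uniq => /andP[].
    apply/hasPn=> t /xW /out; apply: contra => tN.
    by rewrite -[[:: a; p; q; b; r; s]]/([:: a; p; q; b] ++ [:: r; s]) mem_cat; apply/orP; left.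
  apply: contra n2; apply: joined_sub => t.
  rewrite -[[:: p; q; x; z; p'; q']]/([:: p; q] ++ [:: x; z; p'; q']) !mem_cat.
  by case/orP=> [->|/xW->]; rewrite ?orbT.
have red x z y w : uniq [:: x; z; y; w] -> {subset [:: x; z; y; w] <= W} -> hue c [:: x; z; y; w].
  move=> ux xW; apply: contraT => bl.
  have [|p' p'W p'N] := @pick T W uW [:: x; z; y; w]; first by apply: leq_trans szW.
  have [|q' q'W] := @pick T W uW [:: p'; x; z; y; w]; first by apply: leq_trans szW.
  rewrite in_cons negb_or => /andP[qp q'N].
  have u' : uniq [:: x; z; p'; q'].
    move: ux p'N q'N; rewrite /= !inE !negb_or => /and4P[/and3P[-> _ _] _ _ _].
    case/and4P=> px pz _ _ /and4P[qx qz _ _].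
    by rewrite eq_sym px eq_sym qx eq_sym pz eq_sym qz eq_sym qp.
  have jb : joined c false 2 x z [:: a; p; q; b; p'; q'].
    apply: blue u' _ => t; rewrite !inE => /or4P[]/eqP-> //; apply: xW.
      exact: mem_head.
    by rewrite !inE eqxx orbT.
  have J : ~~ joined (opposite c) true 2 x z [:: a; p; q; b; p'; q'].
    (* The entries [p'], [q'] after [x] merely stand for the edge to be replaced; the blue edge
       leads from [z] through [y] and [w] back to [x]. *)
    apply: (@no_shortcut T _ 2 _ 1 x [:: p'; q'] z [:: y; w]) => //.
    - by move=> l; rewrite cyc_opposite; apply: noblue.
    - rewrite (perm_uniq (s2 := [:: x; z; y; w] ++ [:: p'; q'])); last first.
        by apply/permP=> ?; rewrite /=; clear; lia.
      rewrite cat_uniq; apply/and3P; split; [exact: ux | | by rewrite /= inE eq_sym qp].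
      by apply/hasPn=> t; rewrite !in_cons in_nil orbF => /orP[]/eqP->; [exact: p'N | exact: q'N].
    - rewrite /= andbT; apply/eqP; rewrite /opposite /hue.
      rewrite -[c _]/(hue c [:: z; y; w; x]) (@hue_eq _ _ _ [:: x; z; y; w]) ?bl // => t.
      by rewrite !inE; case: (t == x); case: (t == y); case: (t == z); case: (t == w).
    move=> t tA.
    have tzyw : t \in [:: z; y; w] -> (t \in W) && (t != p') && (t != q').
      move=> tz; have tx : t \in [:: x; z; y; w] by rewrite in_cons tz orbT.
      rewrite xW //=; apply/andP; split; apply: contraTneq tx => ->; [exact: p'N | exact: q'N].
    apply/negP=> /tzyw /andP[/andP[/out tN tp] tq]; move: tA tN; rewrite !inE.
    by rewrite (negbTE tp) (negbTE tq) !orbF !negb_or => /or4P[]->; rewrite ?andbF.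
  by rewrite joined_opposite jb in J.
case: W uW out szW red {n2 blue} => [|w1 [|w2 [|w3 [|w4 [|w5 [|w6 [|w7 [|w8 W]]]]]]]] // uW out _ red.
have uw : uniq [:: w1; w2; w3; w4; w5; w6; w7; w8].
  have : uniq ([:: w1; w2; w3; w4; w5; w6; w7; w8] ++ W) := uW.
  by rewrite [uniq (_ ++ W)]cat_uniq => /andP[].
have sw l : {subset l <= [:: w1; w2; w3; w4; w5; w6; w7; w8]} ->
    {subset l <= [:: w1, w2, w3, w4, w5, w6, w7, w8 & W]}.
  move=> sl t /sl; rewrite -[[:: w1, w2, w3, w4, w5, w6, w7, w8 & W]]/([:: w1; w2; w3; w4; w5;
    w6; w7; w8] ++ W).
  by rewrite mem_cat => ->.
have redw x z y w l : perm_eq [:: w1; w2; w3; w4; w5; w6; w7; w8] ([:: x; z; y; w] ++ l) ->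
    hue c [:: x; z; y; w].
  move=> pe; apply: red; first by move: uw; rewrite (perm_uniq pe) cat_uniq => /andP[].
  by apply: sw => t tx; rewrite (perm_mem pe) mem_cat tx.
have out3 v : v \in [:: a; p; q; b; r; s] -> v \notin [:: w1; w2; w3; w4; w5; w6; w7; w8].
  by move=> v6; apply/negP=> /(sw _ (fun t h => h)) /out; rewrite v6.
have through v x1 x2 x3 x4 x5 x6 x7 x8 : v \in [:: a; p; q; b; r; s] ->
    perm_eq [:: w1; w2; w3; w4; w5; w6; w7; w8] [:: x1; x2; x3; x4; x5; x6; x7; x8] ->
    ~~ hue c [:: x1; v; x2; x3].
  move=> v6 pe; apply/negP=> hv.
  have /negP := nored [:: x1; v; x2; x3; x4; x5; x6; x7; x8]; apply.
  apply/and3P; split=> //.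
    rewrite (perm_uniq (s2 := v :: [:: w1; w2; w3; w4; w5; w6; w7; w8])) ?cons_uniq ?out3 //.
    rewrite -(perm_cons v) in pe; rewrite perm_sym; apply: perm_trans pe _.
    by apply/permP=> ?; rewrite /=; clear; lia.
  rewrite /= hv (redw x3 x4 x5 x6 [:: x1; x2; x7; x8]) ?(redw x6 x7 x8 x1 [:: x2; x3; x4; x5]) //.
    by apply: perm_trans pe _; apply/permP=> ?; rewrite /=; clear; lia.
  by apply: perm_trans pe _; apply/permP=> ?; rewrite /=; clear; lia.
have /negP := noblue [:: w1; a; w2; w3; p; w4; w5; q; w6]; apply; apply/and3P; split=> //.
  rewrite (perm_uniq (s2 := [:: w1; w2; w3; w4; w5; w6] ++ [:: a; p; q])); last first.
    by apply/permP=> ?; rewrite /=; clear; lia.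
  rewrite cat_uniq; apply/and3P; split.
  - by have : uniq ([:: w1; w2; w3; w4; w5; w6] ++ [:: w7; w8]) := uw;
    rewrite cat_uniq => /andP[].
  - apply/hasPn=> t tapq; have /out3 : t \in [:: a; p; q; b; r; s].
      by move: tapq; rewrite !inE => /or3P[]->; rewrite ?orbT.
    by apply: contra => tw; rewrite -[[:: w1; w2; w3; w4; w5; w6; w7; w8]]/([:: w1; w2; w3; w4;
      w5; w6] ++ [:: w7; w8]) mem_cat; apply/orP; left.
  by have : uniq ([:: a; p; q] ++ [:: b; r; s]) := u6; rewrite cat_uniq => /andP[].
have T1 := through a w1 w2 w3 w4 w5 w6 w7 w8.
have T2 := through p w3 w4 w5 w6 w7 w8 w1 w2.
have T3 := through q w5 w6 w1 w2 w3 w4 w7 w8.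
rewrite /= !eqbF_neg T1 ?T2 ?T3 ?inE ?eqxx ?orbT //.
  by apply/permP=> ?; rewrite /=; clear; lia.
by apply/permP=> ?; rewrite /=; clear; lia.
Qed.

Definition has_cyc c b n := [exists t : (3 * n).-tuple T, cyc c b n t].

Lemma has_cycP c b n : reflect (exists l, cyc c b n l) (has_cyc c b n).
Proof.
apply: (iffP existsP) => [[t ct]|[l cl]]; first by exists t.
by have /and3P[szl _ _] := cl; exists (Tuple szl).
Qed.

Lemma has_cyc_opposite c b n : has_cyc (opposite c) b n = has_cyc c (~~ b) n.
Proof. by apply: eq_existsb => t; rewrite cyc_opposite. Qed.

Lemma two_edges_mono c b (a p q d r s : T) :
  uniq [:: a; p; q; d; r; s] -> hue c [:: a; p; q; d] = b -> hue c [:: d; r; s; a] = b ->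
  13 < #|T| -> has_cyc c true 3 || has_cyc c false 3.
Proof.
move=> u6 h1 h2 cT; rewrite -[_ || _]negbK negb_or; apply/negP=> /andP[nr nb].
have no c' b' : ~~ has_cyc c' b' 3 -> forall l, ~~ cyc c' b' 3 l.
  by move=> nc l; apply: contra nc => cl; apply/has_cycP; exists l.
case: b h1 h2 => h1 h2; first exact: (two_edges u6 h1 h2 cT (no _ _ nr) (no _ _ nb)).
have h1' : hue (opposite c) [:: a; p; q; d] by rewrite /hue /opposite -/(hue c _) h1.
have h2' : hue (opposite c) [:: d; r; s; a] by rewrite /hue /opposite -/(hue c _) h2.
by apply: (two_edges u6 h1' h2' cT); apply: no; rewrite has_cyc_opposite.
Qed.

(** Of the three edges formed by two of the pairs {x0, x1}, {x2, x3}, {x4, x5}, two have the same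
    colour, and these share exactly one pair. *)
Lemma three_cycle c : 13 < #|T| -> has_cyc c true 3 || has_cyc c false 3.
Proof.
move=> cT; have : size (enum T) > 13 by rewrite -cardE.
have := enum_uniq T.
case: (enum T) => [|x0 [|x1 [|x2 [|x3 [|x4 [|x5 l]]]]]] // uT _.
have {uT}u : uniq [:: x0; x1; x2; x3; x4; x5].
  have : uniq ([:: x0; x1; x2; x3; x4; x5] ++ l) := uT.
  by rewrite [uniq (_ ++ l)]cat_uniq => /andP[].
pose e1 := hue c [:: x0; x2; x3; x1]; pose e2 := hue c [:: x1; x4; x5; x0].
pose e3 := hue c [:: x2; x4; x5; x3].
have [E12|E12] := eqVneq e1 e2.
  apply: (@two_edges_mono c e1 x0 x2 x3 x1 x4 x5) => //.
  by rewrite (perm_uniq (s2 := [:: x0; x1; x2; x3; x4; x5])) //; apply/permP=> ?; rewrite /=;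
    clear; lia.
have [E13|E13] := eqVneq e1 e3.
  apply: (@two_edges_mono c e1 x2 x0 x1 x3 x4 x5) => //.
  - by rewrite (perm_uniq (s2 := [:: x0; x1; x2; x3; x4; x5])) //; apply/permP=> ?; rewrite /=;
    clear; lia.
  - by apply: hue_eq => t; rewrite !inE; case: (t == x0); case: (t == x1); case: (t == x2);
    case: (t == x3).
  rewrite E13; apply: hue_eq => t; rewrite !inE.
  by case: (t == x2); case: (t == x3); case: (t == x4); case: (t == x5).
have E23 : e2 = e3 by move: E12 E13; case: e1; case: e2; case: e3.
apply: (@two_edges_mono c e2 x4 x0 x1 x5 x2 x3) => //.
- by rewrite (perm_uniq (s2 := [:: x0; x1; x2; x3; x4; x5])) //; apply/permP=> ?; rewrite /=;
  clear; lia.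
- by apply: hue_eq => t; rewrite !inE; case: (t == x0); case: (t == x1); case: (t == x4);
  case: (t == x5).
rewrite E23; apply: hue_eq => t; rewrite !inE.
by case: (t == x2); case: (t == x3); case: (t == x4); case: (t == x5).
Qed.

Lemma next_cycle c n l : 2 < n -> 3 * n.+1 + n.+1./2 <= #|T| -> cyc c true n l ->
  has_cyc c true n.+1 || has_cyc c false n.+1.
Proof.
move=> n3 cT cl; rewrite -[_ || _]negbK negb_or; apply/negP=> /andP[nr nb].
have no b' : ~~ has_cyc c b' n.+1 -> forall l, ~~ cyc c b' n.+1 l.
  by move=> nc l'; apply: contra nc => cl'; apply/has_cycP; exists l'.
have [W [uW out szW]] := outside_seq l.
have /and3P[/eqP szl _ _] := cl.
apply: (step_absurd (no _ nr) (no _ nb) n3 uW _ cl out).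
apply: leq_trans szW; rewrite szl; move: cT; rewrite -uphalfE uphalf_half.
by case: (odd n); clear; lia.
Qed.

Lemma mono_cycle c n : 3 < n -> 3 * n + n./2 <= #|T| ->
  has_cyc c true n || has_cyc c false n.
Proof.
have step n' : 2 < n' -> 3 * n'.+1 + n'.+1./2 <= #|T| ->
    has_cyc c true n' || has_cyc c false n' -> has_cyc c true n'.+1 || has_cyc c false n'.+1.
  move=> n3 cT /orP[] /has_cycP[l cl]; first exact: next_cycle cl.
  have := @next_cycle (opposite c) n' l n3 cT; rewrite cyc_opposite => /(_ cl).
  by rewrite !has_cyc_opposite orbC.
case: n => // n; elim: n => // n IH n3 cT; apply: step => //.
have [n4|n4] := ltnP 3 n.+1; last first.
  have -> : n.+1 = 3 by move: n3 n4; clear; lia.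
  (* The bound on [#|T|] is here the one for four edges: 12 + 2 = 14. *)
  apply: three_cycle; apply: leq_trans cT.
  by have := half_leq n3; move: n3; rewrite [4./2]/=; clear; lia.
apply: IH => //; apply: leq_trans cT; apply: leq_add; first by clear; lia.
exact: half_leq.
Qed.

End Base.

(** * Translation to the indexed loose cycle *)

Lemma lpath_nth (T : finType) (c : {set T} -> bool) b l y n i :
  size l = 3 * n -> lpath c b l y -> i < n ->
  hue c [:: nth y l (3 * i); nth y l (3 * i + 1); nth y l (3 * i + 2); nth y l (3 * i + 3)] = b.
Proof.
elim: n i l => // n IH i l; rewrite mulnS.
case: l => [|x [|p [|q l]]] //= [szl] /andP[/eqP h pl].
case: i => [_|i ni]; first by rewrite -h; congr (hue _ [:: _; _; _; _]); case: l {szl pl h}.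
have e k : 3 * i.+1 + k = (3 * i + k).+3 by clear; lia.
rewrite -[3 * i.+1]addn0 !e addn0 /=; exact: IH.
Qed.

Lemma cyc_mono N (c : coloring N) b n : 0 < n -> has_cyc c b n -> mono_loose_cycle c b n.
Proof.
move=> n0 /has_cycP[l cl]; have /and3P[/eqP szl ul pl] := cl.
case: l szl ul pl {cl} => [|x l] szl ul pl; first by exfalso; move: szl n0 => /=; clear; lia.
exists (nth x (x :: l)); split.
  move=> i j; rewrite !inE -szl => il jl /eqP; rewrite nth_uniq // => /eqP //.
(* Index 3n falls outside the list, where the default [x] of [nth] is the first vertex, as the
   modulus requires. *)
move=> i ni; have E : nth x (x :: l) ((3 * i + 3) %% (3 * n)) = nth x (x :: l) (3 * i + 3).
  have [ni1|ni1] := ltnP i.+1 n; first by rewrite modn_small //; move: ni1; clear; lia.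
  have -> : 3 * i + 3 = 3 * n by move: ni ni1; clear; lia.
  by rewrite modnn [RHS]nth_default ?szl.
rewrite -(lpath_nth szl pl ni) /hue -E.
by congr c; apply/setP=> t; rewrite !inE.
Qed.

(* R(C^4_n, C^4_n) <= 3n + floor(n/2): K^4_N with N = 3n + floor(n/2)
   already has the Ramsey property (so the least such N is at most this). *)
Theorem theorem3p3 (n : nat) (hn : 4 <= n) :
  ramsey_arrows (3 * n + n./2) n n.
Proof.
move=> c; have n0 : 0 < n by apply: leq_trans hn.
have : 3 * n + n./2 <= #|'I_(3 * n + n./2)| by rewrite card_ord.
by move=> /(mono_cycle c hn)/orP[]/(cyc_mono n0); [left | right].
Qed.
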